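(* Let the orthogonal matrix $H\in\mathbb R^{L\times L}$ satisfy: for any binary vector $\omega\in\{0,1\}^L$, $\|H^T\omega\|_\infty\le\|\omega\|_1/\sqrt L$, and $H\mathbf 1=\sqrt L\,e_1$, where $\mathbf 1=(1,\dots,1)^T$ and $e_1=(1,0,\dots,0)^T$. Consider the DSBM where $G\in\mathcal G_{m,L,s}$ with $s\ge\kappa m^2$, where $\kappa>0$ is independent of $m,n$ and $L$. Denote $\gamma=\min(\kappa,1/2)$, $M=m(m+1)/2$, and assume that $L\ge2$, $n\ge2m$, $n_0\le\min(\gamma n,\tfrac43\gamma n\,m^{-1/9})$ and $s$ is such that $$s^2\log(2LM/s)\le68\,LMn^2.$$ Then $$\inf_{\hat\Lambda}\ \sup_{\substack{G\in\mathcal G_{m,L,s}\\ C\in\mathcal Z(m,n,n_0,L)}}\mathbb P_\Lambda\left\{\frac{\|\hat\Lambda-\Lambda\|^2}{n^2L}\ge C(\gamma)\left(\frac{\log m}{nL}+\frac{n_0}{n^2}\log\Big(\frac{mne}{n_0}\Big)+\frac{s\log(Lm^2/s)}{n^2L}\right)\right\}\ge\frac14,$$ where $\hat\Lambda$ is any estimator of $\Lambda$, $\mathbb P_\Lambda$ is the probability under the true value of the tensor $\Lambda$, and $C(\gamma)$ is an absolute constant that depends on $\gamma$ only.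
   Context: Observations: $B_{i,j,l}\in\{0,1\}$ for $1\le i,j\le n$, $1\le l\le L$, with $B_{i,j,l}=B_{j,i,l}$, $B_{i,i,l}=0$, and $\{B_{i,j,l}: i<j,\ 1\le l\le L\}$ independent Bernoulli variables with $\mathbb P_\Lambda(B_{i,j,l}=1)=\Lambda_{i,j,l}$. Estimators $\hat\Lambda$ are functions of $B$. Clustering: $\mathcal M(m,n)$ is the set of $Z\in\{0,1\}^{n\times m}$ with exactly one 1 in each row ($Z_{ik}=1$ iff node $i$ is in class $\Omega_k$). $\mathcal Z(m,n,n_0,L)$ is the set of sequences $(Z^{(1)},\dots,Z^{(L)})\in\prod_{l=1}^L\mathcal M(m,n)$ such that at most $n_0$ nodes change class between any two consecutive times; such a sequence is denoted $C$. DSBM: a connectivity tensor $G\in[0,1]^{m\times m\times L}$ with $G_{k,k',l}=G_{k',k,l}$ and a sequence $C\in\mathcal Z(m,n,n_0,L)$ determine $\Lambda$ by $\Lambda_{i,j,l}=G_{k,k',l}$ for $i\neq j$ if $i\in\Omega_k$ and $j\in\Omega_{k'}$ at time $l$, and $\Lambda_{i,i,l}=0$. Sparsity class: $q^{(l)}\in\mathbb R^M$ is the vector of entries $G_{k_1,k_2,l}$ with $k_1\le k_2$; $q\in\mathbb R^{ML}$ is obtained by stacking $q^{(1)},\dots,q^{(L)}$; $W=H\otimes I_M$. $\mathcal G_{m,L,s}$ is the collection of connectivity tensors $G$ for which $q=W^Td$ with $\|d\|_0\le s$ (at most $s$ nonzero entries). $\|\cdot\|$ for tensors is the square root of the sum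 of squared entries. The term $n_0\log(mne/n_0)$ is $0$ if $n_0=0$.
   Formalization: Three degenerate corners where the claim fails are excluded: m=1 with n_0>0 (a single class cannot change, so the n_0 term is spurious), s=1 (one time-constant block), and m=s=2 (a zero block reveals the classes). *)

(* Defs.v *)
From HB Require Import structures.
From mathcomp Require Import all_boot all_order all_algebra.
From mathcomp Require Import all_classical all_reals all_analysis.
From mathcomp Require Import mxtens.

Set Implicit Arguments.
Unset Strict Implicit.
Unset Printing Implicit Defensive.
Import Order.TTheory GRing.Theory Num.Theory.
Import numFieldNormedType.Exports.

Local Open Scope classical_set_scope.
Local Open Scope ring_scope.

Definition tensor (T : Type) (a b c : nat) := 'I_a -> 'I_b -> 'I_c -> T.

Definition tensor_sub (R : realType) (a b c : nat) (A B : tensor R a b c)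
  : tensor R a b c := fun i j l => A i j l - B i j l.

Definition tensor_norm (R : realType) (a b c : nat) (A : tensor R a b c) : R :=
  Num.sqrt (\sum_i \sum_j \sum_l A i j l ^+ 2).

(* The free coordinates (i, j, l), i < j, of a symmetric hollow tensor. *)
Definition edge (n L : nat) :=
  {e : 'I_n * 'I_n * 'I_L | (e.1.1 < e.1.2)%N}.

(* The tensor B with B i j l = B j i l = x (i, j, l) for i < j, B i i l = 0. *)
Definition obs (n L : nat) (x : {ffun edge n L -> bool}) : tensor bool n n L :=
  fun i j l =>
    [exists e, x e && ((val e == (i, j, l)) || (val e == (j, i, l)))].

Definition edge_prob (R : realType) (n L : nat) (Lam : tensor R n n L)
  (e : edge n L) : R := Lam (val e).1.1 (val e).1.2 (val e).2.

(* Probability of the event E about B, the free coordinates of B being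
   independent Bernoulli variables with means Lam i j l, i.e. having as joint
   law the product of the Bernoulli laws. *)
Definition Prob (R : realType) (n L : nat) (Lam : tensor R n n L)
  (E : pred (tensor bool n n L)) : R :=
  \sum_(x : {ffun edge n L -> bool} | E (obs x))
    \prod_e bernoulli_pmf (edge_prob Lam e) (x e).

Definition estimator (R : realType) (n L : nat) :=
  tensor bool n n L -> tensor R n n L.

Definition is_clustering (m n : nat) (Z : 'M[bool]_(n, m)) : Prop :=
  forall i, #|[set k | Z i k]%SET| = 1%N.

Definition clustering_seqs (m n n0 L : nat) : set ('I_L -> 'M[bool]_(n, m)) :=
  [set C | (forall l, is_clustering (C l)) /\
           (forall l l' : 'I_L, l' = l.+1 :> nat ->
              (#|[set i | row i (C l) != row i (C l')]%SET| <= n0)%N)].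

Definition is_connectivity (R : realType) (m L : nat) (G : tensor R m m L)
  : Prop := forall k k' l, 0 <= G k k' l <= 1 /\ G k k' l = G k' k l.

(* For clusterings, the inner sum has exactly one term: the classes of i and j
   at time l. *)
Definition dsbm (R : realType) (m n L : nat) (G : tensor R m m L)
  (C : 'I_L -> 'M[bool]_(n, m)) : tensor R n n L :=
  fun i j l =>
    if i == j then 0 else
    \sum_(p : 'I_m * 'I_m | C l i p.1 && C l j p.2) G p.1 p.2 l.

(* Index type of the distinct blocks; M is its cardinal, m (m + 1) / 2 by
   card_block below, and enum_val lists it lexicographically. *)
Definition block (m : nat) := {p : 'I_m * 'I_m | (p.1 <= p.2)%N}.

Definition nblocks (m : nat) : nat := #|{: block m}|.

(* The stacking of q^(1), ..., q^(L); mxtens_index (l, a) is l * M + a. *)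
Definition stacked (R : realType) (m L : nat) (G : tensor R m m L)
  : 'cV[R]_(L * nblocks m) :=
  \col_a let la := mxtens_unindex a in
    G (val (enum_val la.2)).1 (val (enum_val la.2)).2 la.1.

Definition l0norm (R : realType) (p : nat) (d : 'cV[R]_p) : nat :=
  #|[set a | d a 0 != 0]%SET|.

(* *t is the Kronecker product. *)
Definition sparse_connectivity (R : realType) (L : nat) (m s : nat) (H : 'M[R]_L)
  : set (tensor R m m L) :=
  [set G | is_connectivity G /\
     exists d : 'cV[R]_(L * nblocks m),
       stacked G = (H *t (1%:M : 'M[R]_(nblocks m)))^T *m d /\
       (l0norm d <= s)%N].

(* `|_| is the maximum norm on vectors. *)
Definition admissible_transform (R : realType) (L : nat) (H : 'M[R]_L) : Prop :=
  [/\ H^T *m H = 1%:M,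
      forall omega : 'cV[bool]_L,
        let w : 'cV[R]_L := map_mx (fun b : bool => b%:R) omega in
        `| H^T *m w | <= (\sum_l `| w l 0 |) / Num.sqrt L%:R
    & H *m const_mx 1 =
      Num.sqrt L%:R *: (\col_l (val l == 0%N)%:R : 'cV[R]_L)].

Arguments clustering_seqs : clear implicits.
Arguments sparse_connectivity {R L} m s H.

Lemma card_block (m : nat) : nblocks m = (m * m.+1)./2.
Proof.
rewrite /nblocks card_sig -sum1_card.
rewrite -(pair_big_dep xpredT (fun i j : 'I_m => (i <= j)%N) (fun _ _ => 1%N)) /=.
rewrite (exchange_big_dep xpredT) //= (eq_bigr (fun j : 'I_m => j.+1)); last first.
  move=> j _.
  by rewrite -(big_ord_widen m (fun=> 1%N) (ltn_ord j)) sum1_card card_ord.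
rewrite -(big_mkord xpredT S) mulnC -(bin2 m.+1) -bin2_sum.
by rewrite big_nat_recl.
Qed.

Lemma obsE (n L : nat) (x : {ffun edge n L -> bool}) (e : edge n L) :
  obs x (val e).1.1 (val e).1.2 (val e).2 = x e.
Proof.
apply/existsP/idP => [[f /andP[xf]]|xe]; last first.
  by exists e; rewrite xe; case: e {xe} => -[[i j] l] p /=; rewrite eqxx.
case: e f xf => -[[i j] l] /= lij [[[i' j'] l'] /= lij'] xf.
case/orP => /eqP[ei ej el]; subst.
  by rewrite (_ : exist _ _ _ = exist _ (i, j, l) lij') //; apply: val_inj.
by move: (ltn_trans lij lij'); rewrite ltnn.
Qed.

Lemma obs_sym (n L : nat) (x : {ffun edge n L -> bool}) i j l :
  obs x i j l = obs x j i l.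
Proof. by apply: eq_existsb => e; rewrite orbC. Qed.

Lemma obs_diag (n L : nat) (x : {ffun edge n L -> bool}) i l :
  obs x i i l = false.
Proof.
apply/existsP => -[[[[j k] l'] /= ljk]].
by rewrite orbb => /andP[_ /eqP[ej ek _]]; move: ljk; rewrite ej ek ltnn.
Qed.

(* Together with Prob_total, this is the mutual independence of the Bernoulli
   variables B i j l, i < j. *)
Lemma Prob_cylinder (R : realType) (n L : nat) (Lam : tensor R n n L)
    (S : {set edge n L}) (b : edge n L -> bool) :
  Prob Lam (fun B => [forall (e | e \in S),
              B (val e).1.1 (val e).1.2 (val e).2 == b e]) =
  \prod_(e in S) bernoulli_pmf (edge_prob Lam e) (b e).
Proof.
pose Q e := [pred c : bool | (e \in S) ==> (c == b e)].
have QE e c : (c \in Q e) = ((e \in S) ==> (c == b e)) by [].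
rewrite /Prob (eq_bigl (fun x => x \in family Q)); last first.
  by move=> x; apply/forallP/familyP => h e; move: (h e);
    rewrite QE obsE.
rewrite -(bigA_distr_big_dep _ (fun e c => bernoulli_pmf (edge_prob Lam e) c)).
rewrite [RHS]big_mkcond /=; apply: eq_bigr => e _.
rewrite (eq_bigl (fun c => (e \in S) ==> (c == b e))) //.
by case: (e \in S) => /=; rewrite ?big_pred1_eq // big_bool /= addrC subrK.
Qed.

Lemma Prob_total (R : realType) (n L : nat) (Lam : tensor R n n L) :
  Prob Lam xpredT = 1.
Proof.
have := Prob_cylinder Lam finset.set0 (fun=> true).
rewrite big_set0 => <-; apply: eq_bigl => x; apply/esym/forallP => e.
by rewrite inE.
Qed.

(* Main.v *)
Require Import Defs.
From HB Require Import structures.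
From mathcomp Require Import all_boot all_order all_algebra.
From mathcomp Require Import all_classical all_reals all_analysis.
From mathcomp Require Import mxtens zify ring lra.
Import Order.TTheory GRing.Theory Num.Theory.
Import numFieldNormedType.Exports.
Set Implicit Arguments.
Unset Strict Implicit.
Unset Printing Implicit Defensive.
Local Open Scope classical_set_scope.
Local Open Scope ring_scope.

(* Each of the three terms of the rate is a lower bound on its own, so it is
   enough to treat them separately. Each one comes from a family of tensors
   indexed by all the words [{ffun I -> A}], on which the squared distance
   dominates the Hamming distance, and which stays close in chi-square
   divergence to one tensor [Q] with entries 1/2 wherever the family varies.
   A Fano-type argument with the chi-square divergence in place of the
   Kullback-Leibler divergence then applies; since Hamming balls of radius
   #|I|/16 are exponentially small, the whole product space serves as the
   packing and no Varshamov-Gilbert extraction is needed.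
   - Sparsity term: spikes in the [H]-basis, [t] of them in each of [b] blocks;
     [H] being orthogonal, distances are computed on the coefficients.
   - Clustering terms: [G] is constant in time; the nodes of the first half are
     moved between classes which a Walsh code tells apart through their links
     to the second half. Nodes moved once and for all give [log m], and at most
     [n0] nodes moved at the odd times only give the [n0] term. *)

(** * Hamming balls *)

(** The entries of the family must lie in [0, 1] while [G] has few coefficients in the [H]-basis.
    Raising all blocks to 1/2 could exceed the sparsity, so only the blocks in use are raised; the
    others are 0, and there the family agrees with [Q]. The two properties of [H] set the prices:
    [H 1 = sqrt L e_1] makes raising a block cost one coefficient, and the bound on [H^T omega]
    keeps [t] spikes of height [delta] admissible when [2 delta t <= sqrt L]. The chi-square budget
    asks for [delta^2] of order [ln (L / t) / (n / m)^2]; the hypothesis on [s^2 log (2 L M / s)]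
    makes the two compatible. For the clustering terms, the sparsity may restrict the code to about
    [sqrt s] classes, still at least a multiple of [sqrt gamma * m]; only the logarithm of that
    number enters the rate, hence a factor [1 + |ln gamma|] in the constant. *)

Definition hamming (I A : finType) (x y : {ffun I -> A}) : nat :=
  #|[set i | x i != y i]%SET|.

(** The exponential weight is a product over positions, so the sum over words factors: a position
    contributes 1 for the letter of [x] and [expR (- a)] for every other letter. *)
Lemma sum_expR_hamming (R : realType) (I A : finType) (x : {ffun I -> A})
    (a : R) :
  \sum_(y : {ffun I -> A}) expR (- (a * (hamming x y)%:R))
  = (1 + (#|A|%:R - 1) * expR (- a)) ^+ #|I|.
Proof.
have Fy (y : {ffun I -> A}) : expR (- (a * (hamming x y)%:R))
    = \prod_i (if x i != y i then expR (- a) else 1).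
  rewrite -big_mkcond /= prodr_const -expRM_natr mulNr /hamming cardsE.
  by congr (expR (- (a * _%:R))).
under eq_bigr => y _ do rewrite Fy.
rewrite -(bigA_distr_bigA (fun i c => if x i != c then expR (- a) else 1)) /=.
rewrite -prodr_const; apply: eq_bigr => i _.
rewrite (bigD1 (x i)) //= eqxx /=; congr (_ + _).
rewrite (eq_bigr (fun=> expR (- a))) => [|c cx]; last by rewrite eq_sym cx.
rewrite sumr_const (cardC1 (x i)) -[LHS]mulr_natl.
congr (_ * _); have : (0 < #|A|)%N by apply/card_gt0P; exists (x i).
by case: #|A| => // k _; rewrite -natr1 addrK.
Qed.

(* Chernoff bound with [a = 2 * ln #|A|] in [sum_expR_hamming]. *)
Lemma card_hamming_ball (R : realType) (I A : finType) (x : {ffun I -> A}) :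
  (1 < #|A|)%N ->
  #|[set y | (16 * hamming x y < #|I|)%N]%SET|%:R
  <= expR (3 / 4 * (#|I|%:R * ln #|A|%:R)) :> R.
Proof.
move=> A1; set q : R := #|A|%:R.
have q2 : 2 <= q by rewrite /q ler_nat.
have q0 : 0 < q by apply: lt_le_trans q2.
set a := ln q.
have ea : expR a = q by rewrite /a lnK ?posrE.
have le1 : #|[set y | (16 * hamming x y < #|I|)%N]%SET|%:R <=
   \sum_(y : {ffun I -> A})
     expR (a * #|I|%:R / 8) * expR (- (2 * a * (hamming x y)%:R)).
  rewrite -sum1_card natr_sum big_mkcond /=.
  apply: ler_sum => y _; rewrite inE.
  case: ifPn => [h|_]; last by rewrite mulr_ge0 ?expR_ge0.
  rewrite -expRD -[leLHS]expR0 ler_expR.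
  have a0 : 0 <= a by rewrite ln_ge0 //; apply: le_trans q2; rewrite ler1n.
  have : 16 * (hamming x y)%:R <= #|I|%:R :> R by rewrite -natrM ler_nat ltnW.
  move=> h1; have h2 := ler_wpM2l a0 h1; lra.
apply: (le_trans le1); rewrite -mulr_sumr sum_expR_hamming -/q.
have -> : 1 + (q - 1) * expR (- (2 * a)) = 1 + (q - 1) / q ^+ 2.
  by rewrite expRN (mulrC 2) expRM_natr ea.
(* Eighth powers remove the fractional exponent: the left side is at most 3/2, and (3/2)^8 < 2^5 <=
   q^5. Together with the 1/8 coming from the radius, 5/8 gives the exponent 3/4. *)
have le2 : 1 + (q - 1) / q ^+ 2 <= expR (5 / 8 * a).
  rewrite -(@ler_pXn2r _ 8) ?nnegrE ?expR_ge0 //; last first.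
    by rewrite addr_ge0 ?divr_ge0 ?exprn_ge0 ?subr_ge0 //; lra.
  have -> : expR (5 / 8 * a) ^+ 8 = q ^+ 5.
    by rewrite -ea -!expRM_natr; congr expR; lra.
  have h : 1 + (q - 1) / q ^+ 2 <= 3 / 2.
    have -> : (3 / 2 : R) = 1 + 1/2 by lra.
    rewrite lerD2l ler_pdivrMr ?exprn_gt0 //.
    have : 0 <= (q - 1) ^+ 2 by apply: sqr_ge0.
    nra.
  apply: (@le_trans _ _ ((3 / 2) ^+ 8)).
    rewrite lerXn2r ?nnegrE //.
    by rewrite addr_ge0 ?divr_ge0 ?exprn_ge0 ?subr_ge0 //; lra.
  apply: (@le_trans _ _ (2 ^+ 5)); first lra.
  by rewrite lerXn2r ?nnegrE //; lra.
have -> : expR (3 / 4 * (#|I|%:R * a)) =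
    expR (a * #|I|%:R / 8) * expR (5 / 8 * a) ^+ #|I|.
  by rewrite -expRM_natr -expRD; congr expR; lra.
rewrite ler_pM2l ?expR_gt0 // lerXn2r ?nnegrE ?expR_ge0 //.
by rewrite addr_ge0 ?divr_ge0 ?exprn_ge0 ?subr_ge0 //; lra.
Qed.

(** The ratio 9/16 is what the balance of two terms in [fano] demands. The exponential bound is sure
    to reach it only with enough positions, hence two regimes: below 16 positions the ball is
    reduced to its centre and [K = 1] does. *)
Lemma exists_ball_bound (R : realType) (I A : finType) :
  (0 < #|I|)%N -> (1 < #|A|)%N ->
  exists2 K : R, 0 < K &
    expR (#|I|%:R * ln #|A|%:R / 8) * K
      <= 9 / 16 * expR (#|I|%:R * ln #|A|%:R) /\
    forall x : {ffun I -> A},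
      #|[set y | (16 * hamming x y < #|I|)%N]%SET|%:R <= K.
Proof.
move=> I0 A1; set E : R := #|I|%:R * ln #|A|%:R.
have e2 : 2 <= expR (ln #|A|%:R) :> R by rewrite lnK ?ler_nat // posrE ltr0n; lia.
have [I16|I16] := ltnP #|I| 16.
- exists 1 => //; split.
    have -> : expR E = expR (7 / 8 * E) * expR (E / 8).
      by rewrite -expRD; congr expR; lra.
    rewrite mulr1 mulrA; apply: ler_peMl; first exact: expR_ge0.
    suff : 16 / 9 <= expR (7 / 8 * E) by lra.
    rewrite -(@ler_pXn2r _ 8) ?nnegrE ?expR_ge0 //.
    have -> : expR (7 / 8 * E) ^+ 8 = expR E ^+ 7.
      by rewrite -!expRM_natr; congr expR; lra.
    apply: (@le_trans _ _ (2 ^+ 7)); first lra.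
    rewrite lerXn2r ?nnegrE ?expR_ge0 // /E mulrC expRM_natr.
    rewrite -{1}(expr1 2); apply: le_trans (_ : 2 ^+ #|I| <= _).
      by rewrite ler_weXn2l //; lra.
    by rewrite lerXn2r ?nnegrE ?expR_ge0.
  move=> x; rewrite -[1]/(1%:R) ler_nat.
  rewrite (_ : [set y | _]%SET = [set x]%SET) ?cards1 //.
  apply/setP => y; rewrite !inE; apply/idP/eqP => [h|->].
    have /eqP : hamming x y = 0%N by lia.
    rewrite cards_eq0 => /eqP h0; apply/ffunP => i.
    by apply/esym/eqP/negPn/negP => xy; move/setP: h0 => /(_ i); rewrite !inE xy.
  by rewrite /hamming (_ : [set i | _]%SET = finset.set0) ?cards0 ?muln0 //;
    apply/setP => i; rewrite !inE eqxx.
- exists (expR (3 / 4 * E)); first exact: expR_gt0.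
  split; last by move=> x; exact: card_hamming_ball.
  rewrite -expRD.
  have -> : expR E = expR (E / 8 + 3 / 4 * E) * expR (E / 8).
    by rewrite -expRD; congr expR; lra.
  rewrite [leRHS]mulrCA; apply: ler_peMr; first exact: expR_ge0.
  suff : 4 <= expR (E / 8) by lra.
  rewrite -(@ler_pXn2r _ 8) ?nnegrE ?expR_ge0 //.
  have -> : expR (E / 8) ^+ 8 = expR E by rewrite -!expRM_natr; congr expR; lra.
  rewrite /E mulrC expRM_natr.
  apply: le_trans (_ : 2 ^+ #|I| <= _); last first.
    by rewrite lerXn2r ?nnegrE ?expR_ge0.
  apply: le_trans (_ : 2 ^+ 16 <= _); first lra.
  by rewrite ler_weXn2l //; lra.
Qed.

(** * A Fano-type inequality for the chi-square divergence *)

Definition likelihood (R : realType) (n L : nat) (Lam : tensor R n n L)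
    (x : {ffun edge n L -> bool}) : R :=
  \prod_e bernoulli_pmf (edge_prob Lam e) (x e).

Definition probabilities (R : realType) (n L : nat) (Lam : tensor R n n L) :=
  forall i j l, 0 <= Lam i j l <= 1.

Definition dist2 (R : realType) (a b c : nat) (A B : tensor R a b c) : R :=
  \sum_i \sum_j \sum_l (A i j l - B i j l) ^+ 2.

Lemma tensor_norm_sub (R : realType) (a b c : nat) (A B : tensor R a b c) :
  tensor_norm (tensor_sub A B) ^+ 2 = dist2 A B.
Proof.
rewrite /tensor_norm sqr_sqrtr //.
by do 3![apply: sumr_ge0 => ? _]; apply: sqr_ge0.
Qed.

Lemma dist2_half_triangle (R : realType) (a b c : nat)
    (A B C : tensor R a b c) :
  dist2 B C <= 2 * dist2 A B + 2 * dist2 A C.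
Proof.
rewrite /dist2 !mulr_sumr -big_split; apply: ler_sum => i _ /=.
rewrite !mulr_sumr -big_split; apply: ler_sum => j _ /=.
rewrite !mulr_sumr -big_split; apply: ler_sum => l _ /=.
have := sqr_ge0 (2 * A i j l - B i j l - C i j l).
by rewrite !expr2; nra.
Qed.

Lemma likelihood_ge0 (R : realType) (n L : nat) (Lam : tensor R n n L) x :
  probabilities Lam -> 0 <= likelihood Lam x.
Proof.
by move=> h; apply: prodr_ge0 => e _; apply: bernoulli_pmf_ge0; apply: h.
Qed.

Lemma sum_likelihood (R : realType) (n L : nat) (Lam : tensor R n n L) :
  \sum_x likelihood Lam x = 1.
Proof. exact: Prob_total. Qed.

(** At [q = 1/2] the sum is exactly [1 + 4 (p - 1/2)^2]. At [p = q] it is 1, also for [q] in {0, 1},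
    because [y^2 / y = y] survives at [y = 0] with [0^-1 = 0]; this admits blocks of value 0. *)
Lemma chi2_bernoulli (R : realType) (p q : R) :
  p = q \/ q = 1 / 2 ->
  \sum_(b : bool) bernoulli_pmf p b ^+ 2 / bernoulli_pmf q b
  <= expR (4 * (p - q) ^+ 2).
Proof.
have sqK (y : R) : y ^+ 2 / y = y.
  by have [->|y0] := eqVneq y 0; rewrite ?expr0n ?mul0r // expr2 mulfK.
case=> ->; rewrite big_bool /=.
  by rewrite !sqK subrr expr0n mulr0 expR0 addrC subrK.
apply: le_trans (expR_ge1Dx _).
rewrite /bernoulli_pmf (_ : 1 - 1 / 2 = 1 / 2); last lra.
by rewrite !expr2; lra.
Qed.

Lemma sum_inj_le (R : realType) (I J : finType) (A : pred I) (h : I -> J)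
    (F : J -> R) :
  {in A &, injective h} -> (forall j, 0 <= F j) ->
  \sum_(i in A) F (h i) <= \sum_j F j.
Proof.
move=> hI F0; rewrite -(big_imset F hI) /= big_mkcond /=.
by apply: ler_sum => j _; case: ifP.
Qed.

Lemma sum_edge_le (R : realType) (n L : nat) (F : 'I_n -> 'I_n -> 'I_L -> R) :
  (forall i j l, 0 <= F i j l) ->
  \sum_(e : edge n L) F (val e).1.1 (val e).1.2 (val e).2
  <= \sum_i \sum_j \sum_l F i j l.
Proof.
move=> F0; rewrite pair_big pair_big /=.
apply: (@sum_inj_le _ _ _ xpredT val (fun p => F p.1.1 p.1.2 p.2)) => //.
by move=> e e' _ _; apply: val_inj.
Qed.

Definition sq_ratio (R : realType) (n L : nat) (Lam Q : tensor R n n L)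
    (x : {ffun edge n L -> bool}) : R :=
  likelihood Lam x ^+ 2 / likelihood Q x.

Lemma sum_sq_ratio (R : realType) (n L : nat) (Lam Q : tensor R n n L) :
  probabilities Lam -> probabilities Q ->
  (forall i j l, Lam i j l = Q i j l \/ Q i j l = 1 / 2) ->
  \sum_x sq_ratio Lam Q x <= expR (4 * dist2 Lam Q).
Proof.
move=> Lp Qp LQ.
pose r (e : edge n L) b :=
  bernoulli_pmf (edge_prob Lam e) b ^+ 2 / bernoulli_pmf (edge_prob Q e) b.
have -> : \sum_x sq_ratio Lam Q x =
    \sum_(x : {ffun edge n L -> bool}) \prod_e r e (x e).
  apply: eq_bigr => x _; rewrite /sq_ratio /likelihood -prodrXl.
  by rewrite -prodf_div.
rewrite -(bigA_distr_bigA r).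
pose G (i j : 'I_n) (l : 'I_L) := 4 * (Lam i j l - Q i j l) ^+ 2.
have G0 i j l : 0 <= G i j l by rewrite mulr_ge0 ?sqr_ge0.
apply: (@le_trans _ _
  (\prod_(e : edge n L) expR (G (val e).1.1 (val e).1.2 (val e).2))).
  apply: ler_prod => e _; apply/andP; split; last first.
    by apply: chi2_bernoulli; apply: LQ.
  apply: sumr_ge0 => b _.
  apply: divr_ge0; first exact: sqr_ge0.
  by apply: bernoulli_pmf_ge0; apply: Qp.
rewrite -expR_sum ler_expR.
apply: (le_trans (sum_edge_le G0)).
rewrite /dist2 mulr_sumr; apply: ler_sum => i _.
by rewrite mulr_sumr; apply: ler_sum => j _; rewrite mulr_sumr.
Qed.

(* Weighted AM-GM: the Cauchy-Schwarz bound
   [(sum p)^2 <= (sum p^2 / q) (sum q)] in additive form. *)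
Lemma likelihood_le (R : realType) (n L : nat) (Lam Q : tensor R n n L) x
    (a : R) :
  probabilities Lam -> probabilities Q ->
  (forall i j l, Lam i j l = Q i j l \/ Q i j l = 1 / 2) -> 0 < a ->
  likelihood Lam x <= a / 2 * sq_ratio Lam Q x + (2 * a)^-1 * likelihood Q x.
Proof.
move=> Lp Qp LQ a0.
(* If [Q] gives [x] mass 0, a single link is responsible; a link of mean 1/2 never has mass 0, so
   [Lam] agrees with [Q] on that link and gives [x] mass 0 as well. *)
have [q0|q0] := eqVneq (likelihood Q x) 0.
  rewrite /sq_ratio q0 invr0 !mulr0 addr0.
  move/eqP: q0; rewrite prodf_seq_eq0 => /hasP[e _ /= /eqP qe].
  rewrite /likelihood (bigD1 e) //=.
  case: (LQ (val e).1.1 (val e).1.2 (val e).2) => [lq|q2].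
    by rewrite /edge_prob lq -/(edge_prob Q e) qe mul0r.
  move: qe; rewrite /edge_prob q2 /bernoulli_pmf; case: (x e); lra.
set p := likelihood Lam x; set q := likelihood Q x in q0 *.
have q_gt0 : 0 < q by rewrite lt_def q0 likelihood_ge0.
rewrite -subr_ge0 /sq_ratio -/p -/q.
have -> : a / 2 * (p ^+ 2 / q) + (2 * a)^-1 * q - p =
          (a * p - q) ^+ 2 / (2 * a * q) by field; rewrite !gt_eqF.
by rewrite divr_ge0 ?sqr_ge0 // !mulr_ge0 // ltW.
Qed.

Lemma Prob_complement (R : realType) (n L : nat) (Lam : tensor R n n L) E :
  Prob Lam E + Prob Lam (predC E) = 1.
Proof.
rewrite -(Prob_total Lam) /Prob [RHS](bigID (fun x => E (obs x))) /=.
by congr (_ + _).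
Qed.

(* Two bad words for the same observation are less than #|I|/16 apart by the
   triangle inequality, hence the bound [K] on their number. *)
Lemma fano (R : realType) (n L : nat) (I A : finType)
    (Lam : {ffun I -> A} -> tensor R n n L) (Q : tensor R n n L) (Delta : R)
    (Lamhat : estimator R n L) :
  (0 < #|I|)%N -> (1 < #|A|)%N -> 0 < Delta ->
  (forall th, probabilities (Lam th)) -> probabilities Q ->
  (forall th i j l, Lam th i j l = Q i j l \/ Q i j l = 1 / 2) ->
  (forall th, 32 * dist2 (Lam th) Q <= #|I|%:R * ln #|A|%:R) ->
  (forall th th', Delta * (hamming th th')%:R <= dist2 (Lam th) (Lam th')) ->
  exists th, 1 / 4 <= Prob (Lam th)
    (fun B => Delta * #|I|%:R / 64 <= dist2 (Lamhat B) (Lam th)).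
Proof.
move=> I0 A1 D0 Lp Qp LQ chi sep.
(* Two bad words are at squared distance below [4 r], and 64 = 4 x 16 turns this into [Delta] times
   the radius [#|I| / 16] of the balls. *)
set r := Delta * #|I|%:R / 64.
have [K K0 [XK ballK]] := @exists_ball_bound R I A I0 A1.
pose X : R := expR (#|I|%:R * ln #|A|%:R / 8).
pose N : R := #|{ffun I -> A}|%:R.
have NE : N = expR (#|I|%:R * ln #|A|%:R).
  rewrite /N card_ffun natrX mulrC expRM_natr lnK //.
  by rewrite posrE ltr0n; lia.
have N0 : 0 < N by rewrite NE expR_gt0.
apply: contrapT => /forallNP noth.
pose good th B := r <= dist2 (Lamhat B) (Lam th).
have bad th : 3 / 4 < Prob (Lam th) (predC (good th)).
  have := Prob_complement (Lam th) (good th).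
  have /negP := noth th; rewrite -ltNge => /= h; rewrite -/(good th) in h.
  lra.
have lt1 : N * (3 / 4) < \sum_th Prob (Lam th) (predC (good th)).
  rewrite /N -sum1_card natr_sum mulr_suml.
  apply: ltr_sum => [|th _]; last by rewrite mul1r.
  have : (0 < #|{ffun I -> A}|)%N by rewrite -(ltr0n R).
  by case/card_gt0P => th _; apply/hasP; exists th; rewrite ?mem_index_enum.
suff : \sum_th Prob (Lam th) (predC (good th)) <= N * (3 / 4).
  by move=> h; move: (lt_le_trans lt1 h); rewrite ltxx.
(* This [a] minimises the bound [N a X / 2 + K / (2 a)] in the extremal case [X K = 9/16 N]; each of
   the two terms is then [3/8 N]. *)
have [a [a0 aE]] : exists a, 0 < a /\ a = 4 / 3 * K / N.
  by exists (4 / 3 * K / N); rewrite divr_gt0 // mulr_gt0.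
apply: (@le_trans _ _
   (\sum_th \sum_x a / 2 * sq_ratio (Lam th) Q x
    + \sum_x \sum_(th | ~~ good th (obs x)) (2 * a)^-1 * likelihood Q x)).
  rewrite [X in _ <= _ + X](exchange_big_dep xpredT) //= -big_split /=.
  apply: ler_sum => th _.
  rewrite [X in _ <= _ + X]big_mkcond /= -big_split /= /Prob big_mkcond /=.
  apply: ler_sum => x _; case: ifP => _.
    exact: likelihood_le.
  rewrite addr0; apply: mulr_ge0; first by rewrite divr_ge0 // ltW.
  by apply: divr_ge0; rewrite ?sqr_ge0 ?likelihood_ge0.
have le1 : \sum_th \sum_x a / 2 * sq_ratio (Lam th) Q x <= N * (a / 2 * X).
  rewrite /N -sum1_card natr_sum mulr_suml; apply: ler_sum => th _.
  rewrite mul1r -mulr_sumr ler_pM2l ?divr_gt0 //.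
  apply: (le_trans (sum_sq_ratio (Lp th) Qp (LQ th))).
  by rewrite ler_expR; have := chi th; lra.
have le2 : \sum_x \sum_(th | ~~ good th (obs x)) (2 * a)^-1 * likelihood Q x
    <= K * (2 * a)^-1.
  rewrite (_ : K / (2 * a) = \sum_x K / (2 * a) * likelihood Q x); last first.
    by rewrite -mulr_sumr sum_likelihood mulr1.
  apply: ler_sum => x _.
  rewrite sumr_const -[leLHS]mulr_natl mulrA ler_wpM2r ?likelihood_ge0 //.
  rewrite ler_wpM2r ?invr_ge0 ?mulr_ge0 ?(ltW a0) //.
  case: (pickP (fun th => ~~ good th (obs x))) => [th0 th0P|none]; last first.
    by rewrite eq_card0 ?ltW.
  apply: le_trans (ballK th0); rewrite ler_nat; apply: subset_leq_card.
  apply/fintype.subsetP => th; rewrite inE unfold_in => thP.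
  have := dist2_half_triangle (Lamhat (obs x)) (Lam th0) (Lam th).
  have := sep th0 th; move: th0P thP; rewrite /good -!ltNge => h0 h1 h2 h3.
  rewrite -(ltr_nat R) -(ltr_pM2l D0) natrM.
  by move: h0 h1; rewrite /r; lra.
apply: (le_trans (lerD le1 le2)).
have -> : N * (a / 2 * X) + K / (2 * a) = 2 / 3 * (X * K) + 3 / 8 * N.
  by rewrite aE; field; rewrite !gt_eqF.
by move: XK; rewrite -NE -/X; lra.
Qed.

(** * Block models and connectivities *)

Definition clustering_of (m n L : nat) (cls : 'I_L -> 'I_n -> 'I_m) :
    'I_L -> 'M[bool]_(n, m) :=
  fun l => \matrix_(i, k) (cls l i == k).

Lemma dsbm_clustering_of (R : realType) (m n L : nat) (G : tensor R m m L)
    (cls : 'I_L -> 'I_n -> 'I_m) i j l :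
  dsbm G (clustering_of cls) i j l =
  if i == j then 0 else G (cls l i) (cls l j) l.
Proof.
rewrite /dsbm; case: eqP => // _.
rewrite (big_pred1 (cls l i, cls l j)) //= => -[k k'] /=.
by rewrite !mxE [RHS]eq_sym xpair_eqE.
Qed.

Lemma clustering_of_seqs (m n n0 L : nat) (cls : 'I_L -> 'I_n -> 'I_m) :
  (forall l l' : 'I_L, l' = l.+1 :> nat ->
     (#|[set i | cls l i != cls l' i]%SET| <= n0)%N) ->
  clustering_seqs m n n0 L (clustering_of cls).
Proof.
move=> h; split=> [l i|l l' ll'].
  rewrite (_ : [set k | _]%SET = [set cls l i]%SET) ?cards1 //.
  by apply/setP => k; rewrite !inE mxE eq_sym.
apply: leq_trans (h l l' ll'); apply: subset_leq_card.
apply/fintype.subsetP => i; rewrite !inE; apply: contra => /eqP e.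
by apply/eqP/rowP => k; rewrite !mxE e.
Qed.

(** Applying [H^T] to [H 1 = sqrt L e_1] shows that a block constant in time costs a single
    coefficient, at index 0. *)
Lemma admissible_const (R : realType) (L : nat) (H : 'M[R]_L) l :
  admissible_transform H ->
  \sum_k H k l * (Num.sqrt L%:R * (val k == 0%N)%:R) = 1.
Proof.
case=> HH _ H1; have := congr1 (fun x => H^T *m x) H1.
rewrite mulmxA HH mul1mx => /matrixP /(_ l 0).
rewrite mxE [RHS]mxE => h; rewrite [RHS]h.
by apply: eq_bigr => k _; rewrite !mxE.
Qed.

Lemma admissible_bound (R : realType) (L : nat) (H : 'M[R]_L) (w : pred 'I_L) l :
  admissible_transform H ->
  `|\sum_k H k l * (w k)%:R| <= #|w|%:R / Num.sqrt L%:R.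
Proof.
case=> _ /(_ (\col_k w k)) h _; move: h => /= h.
set v : 'cV[R]_L := map_mx _ _ in h.
have -> : \sum_k H k l * (w k)%:R = (H^T *m v) l 0.
  by rewrite mxE; apply: eq_bigr => k _; rewrite !mxE.
have -> : #|w|%:R = \sum_k `|v k 0|.
  rewrite -sum1_card natr_sum big_mkcond; apply: eq_bigr => k _.
  by rewrite !mxE unfold_in; case: (w k); rewrite ?normr1 ?normr0.
apply: le_trans h.
rewrite [leRHS]/Num.Def.normr /= mx_normrE; apply/bigmax_geP; right => /=.
by exists (l, 0).
Qed.

Lemma parseval (R : realType) (L : nat) (H : 'M[R]_L) (u : 'I_L -> R) :
  admissible_transform H ->
  \sum_l (\sum_k H k l * u k) ^+ 2 = \sum_k u k ^+ 2.
Proof.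
case=> /mulmx1C HH _ _; pose v : 'cV[R]_L := \col_k u k.
have := congr1 (fun x => (v^T *m x *m v) 0 0) HH.
rewrite /= mulmx1 mulmxA -mulmxA -[H in X in X *m (_ *m _)]trmxK -trmx_mul.
rewrite !mxE => h.
transitivity (\sum_j (H^T *m v)^T 0 j * (H^T *m v) j 0).
  apply: eq_bigr => j _; rewrite expr2 !mxE.
  by congr (_ * _); apply: eq_bigr => k _; rewrite !mxE.
by rewrite h; apply: eq_bigr => k _; rewrite !mxE expr2.
Qed.

Definition block_entry (m : nat) (T : Type) (G : 'I_m -> 'I_m -> T)
    (a : 'I_(nblocks m)) : T :=
  G (val (enum_val a)).1 (val (enum_val a)).2.

(** The second Kronecker factor is the identity, so [W^T] acts on each block separately, as [H^T] on
    the time coefficients [D _ a]; this frees the constructions from the stacked indexing. *)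
Lemma sparse_connectivityI (R : realType) (L m s : nat) (H : 'M[R]_L)
    (G : tensor R m m L) (D : 'I_L -> 'I_(nblocks m) -> R) :
  is_connectivity G ->
  (forall l a, block_entry G a l = \sum_k H k l * D k a) ->
  (#|[set ka : 'I_L * 'I_(nblocks m) | D ka.1 ka.2 != 0%R]%SET| <= s)%N ->
  sparse_connectivity m s H G.
Proof.
move=> Gc GD Ds; split => //.
pose d : 'cV[R]_(L * nblocks m) :=
  \col_x D (mxtens_unindex x).1 (mxtens_unindex x).2.
have dE k b : d (mxtens_index (k, b)) 0 = D k b by rewrite mxE mxtens_indexK.
exists d; split.
  apply/matrixP => x y; rewrite {y}ord1 mxE -[RHS]/(_ _ _).
  case: (mxtens_indexP x) => l a; rewrite mxtens_indexK /=.
  rewrite -[LHS]/(block_entry G a l) GD mxE.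
  rewrite (reindex (@mxtens_index L (nblocks m))) /=; last first.
    by exists (@mxtens_unindex _ _) => z _; rewrite ?mxtens_indexK ?mxtens_unindexK.
  rewrite (eq_bigr (fun p => H p.1 l * (p.2 == a)%:R * D p.1 p.2)); last first.
    by case=> k b _; rewrite dE !mxE !mxtens_indexK.
  rewrite -(pair_bigA _ (fun k b => H k l * (b == a)%:R * D k b)) /=.
  apply: eq_bigr => k _; rewrite (bigD1 a) //= big1 => [|b ba].
    by rewrite addr0 eqxx mulr1.
  by rewrite (negPf ba) mulr0 mul0r.
apply: leq_trans Ds; rewrite /l0norm.
rewrite -(card_imset _ (can_inj (@mxtens_unindexK L (nblocks m)))).
apply: subset_leq_card; apply/fintype.subsetP => ka /imsetP[x].
by rewrite !inE mxE => Dx ->.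
Qed.

(* [r] is a lower bound for the squared error, in the sense of the theorem.
   That the entries of [dsbm G C] lie in [0, 1] is recorded because it makes
   the probability monotone. *)
Definition attainable (R : realType) (m n n0 L s : nat) (H : 'M[R]_L) (r : R) :
    Prop :=
  forall Lamhat : estimator R n L, exists G C,
    [/\ sparse_connectivity m s H G, clustering_seqs m n n0 L C,
        probabilities (dsbm G C) &
        1 / 4 <= Prob (dsbm G C)
                   (fun B => r <= dist2 (Lamhat B) (dsbm G C))].

Lemma attainable_le (R : realType) (m n n0 L s : nat) (H : 'M[R]_L) (r r' : R) :
  r' <= r -> attainable m n n0 s H r -> attainable m n n0 s H r'.
Proof.
move=> rr h Lamhat; have [G [C [GS CS Lp P]]] := h Lamhat.
exists G, C; split => //; apply: (le_trans P).
rewrite /Prob big_mkcond [leRHS]big_mkcond; apply: ler_sum => x _ /=.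
case: ifP => [/(le_trans rr) ->//|_].
by case: ifP => // _; apply: likelihood_ge0.
Qed.

(** * The balanced clustering *)

(** Division by [g] is an injection into [sigma] values. It bounds both the spikes of a block and
    the nodes moved at one time, since each interval of length [g] holds at most one of them. *)
Lemma card_slots (N sigma g : nat) (P : pred 'I_N) :
  (forall i, P i -> (i %/ g < sigma)%N) ->
  (forall i i', P i -> P i' -> (i %/ g = i' %/ g)%N -> i = i') ->
  (#|P| <= sigma)%N.
Proof.
move=> Ps Pinj; case: sigma Ps => [|k] Ps.
  by rewrite leqn0; apply/eqP/eq_card0 => i; apply/negP => /Ps.
suff /leq_card_in : {in P &, injective (fun i : 'I_N => inord (i %/ g) : 'I_k.+1)}.
  by rewrite card_ord.
move=> i i' iP i'P /(congr1 val) /=; rewrite !inordK ?Ps // => h.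
exact: Pinj.
Qed.

Lemma card_ord_lt (N b : nat) : (b <= N)%N -> #|[pred i : 'I_N | (i < b)%N]| = b.
Proof.
move=> bN; rewrite -sum1_card (eq_bigl (fun i : 'I_N => (i < b)%N)) //.
by rewrite -(big_ord_widen N (fun=> 1%N) bN) sum1_card card_ord.
Qed.

Lemma block_subproof (m : nat) (k k' : 'I_m) :
  ((if (k <= k')%N then (k, k') else (k', k)).1 <=
   (if (k <= k')%N then (k, k') else (k', k)).2)%N.
Proof. by case: ifP => //= /negbT; rewrite -ltnNge => /ltnW. Qed.

(** Sorting the pair makes any function of [block_of k k'] symmetric, so a connectivity can be
    prescribed freely on the blocks. *)
Definition block_of (m : nat) (k k' : 'I_m) : 'I_(nblocks m) :=
  enum_rank (exist _ (if (k <= k')%N then (k, k') else (k', k))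
                     (block_subproof k k') : block m).

Lemma block_ofC (m : nat) (k k' : 'I_m) : block_of k k' = block_of k' k.
Proof.
congr enum_rank; apply: val_inj => /=.
by case: ltngtP => // /val_inj ->.
Qed.

Lemma block_ofK (m : nat) (a : 'I_(nblocks m)) :
  block_of (val (enum_val a)).1 (val (enum_val a)).2 = a.
Proof.
apply: (canLR (@enum_valK _)); apply: val_inj => /=.
by have := valP (enum_val a) => /= ->; case: (val _).
Qed.

Lemma val_block_of (m : nat) (k k' : 'I_m) :
  val (enum_val (block_of k k')) = if (k <= k')%N then (k, k') else (k', k).
Proof. by rewrite /block_of enum_rankK. Qed.

Lemma balanced_subproof (m n : nat) (m0 : (0 < m)%N) (i : 'I_n) : (i %% m < m)%N.
Proof. by rewrite ltn_mod. Qed.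

Definition balanced_class (m n : nat) (m0 : (0 < m)%N) (i : 'I_n) : 'I_m :=
  Ordinal (balanced_subproof m0 i).

Lemma node_subproof (m n : nat) (k : 'I_m) (p : 'I_(n %/ m)) : (p * m + k < n)%N.
Proof.
have := ltn_ord p; have := ltn_ord k; have := leq_trunc_div n m.
move: (n %/ m)%N (nat_of_ord p) (nat_of_ord k) => q p' k' h1 h2 h3; nia.
Qed.

Definition node (m n : nat) (k : 'I_m) (p : 'I_(n %/ m)) : 'I_n :=
  Ordinal (node_subproof k p).

Lemma balanced_class_node (m n : nat) (m0 : (0 < m)%N) k p :
  @balanced_class m n m0 (node k p) = k.
Proof. by apply: val_inj; rewrite /= modnMDl modn_small. Qed.

Lemma node_div (m n : nat) (m0 : (0 < m)%N) (k : 'I_m) (p : 'I_(n %/ m)) :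
  (node k p %/ m = p)%N.
Proof. by rewrite /= divnMDl // [(k %/ m)%N]divn_small ?addn0. Qed.

Definition block_pairs (m n : nat) (m0 : (0 < m)%N) (a : 'I_(nblocks m)) :=
  [pred ij : 'I_n * 'I_n | (ij.1 != ij.2) &&
     (block_of (balanced_class m0 ij.1) (balanced_class m0 ij.2) == a)].

(** [bump p] skips the value [p], so the two nodes have different quotients and are distinct even in
    a diagonal block. *)
Lemma card_block_pairs_ge (m n : nat) (m0 : (0 < m)%N) (a : 'I_(nblocks m)) :
  (n %/ m * (n %/ m).-1 <= #|block_pairs n m0 a|)%N.
Proof.
set nu := (n %/ m)%N.
pose k1 := (val (enum_val a)).1; pose k2 := (val (enum_val a)).2.
have bumpP (p : 'I_nu) (p' : 'I_nu.-1) : (bump p p' < nu)%N.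
  by have := ltn_ord p; have := ltn_ord p'; rewrite /bump; case: leqP => /=; lia.
pose h (x : 'I_nu * 'I_nu.-1) : 'I_n * 'I_n :=
  (node k1 x.1, node k2 (Ordinal (bumpP x.1 x.2))).
have hI : injective h.
  move=> [p p'] [r r'] /pair_equal_spec[e1 e2].
  have e : p = r.
    apply: val_inj; have := congr1 (fun i : 'I_n => i %/ m)%N e1.
    by rewrite !(node_div m0).
  subst r; congr (_, _); apply: val_inj; apply: (can_inj (bumpK p)).
  by have := congr1 (fun i : 'I_n => i %/ m)%N e2; rewrite !(node_div m0).
have <- : #|(h @: [set: 'I_nu * 'I_nu.-1])%SET| = (nu * nu.-1)%N.
  by rewrite card_imset // cardsT card_prod !card_ord.
apply: subset_leq_card; apply/fintype.subsetP => _ /imsetP[[p p'] _ ->].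
rewrite inE /= !balanced_class_node block_ofK eqxx andbT.
apply/eqP => /(congr1 (fun i : 'I_n => i %/ m)%N).
by rewrite !(node_div m0) /=; apply/eqP; rewrite neq_bump.
Qed.

(** A node is determined by its class and its quotient. The block gives the two classes up to order
    and a boolean restores the order, hence the factor 2. *)
Lemma card_block_pairs_le (m n : nat) (m0 : (0 < m)%N) (a : 'I_(nblocks m)) :
  (#|block_pairs n m0 a| <= 2 * (n %/ m).+1 ^ 2)%N.
Proof.
set nu := (n %/ m)%N.
have divP (i : 'I_n) : (i %/ m < nu.+1)%N.
  by rewrite ltnS leq_div2r // ltnW.
pose h (ij : 'I_n * 'I_n) : bool * ('I_nu.+1 * 'I_nu.+1) :=
  ((balanced_class m0 ij.1 <= balanced_class m0 ij.2)%N,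
   (Ordinal (divP ij.1), Ordinal (divP ij.2))).
have -> : (2 * nu.+1 ^ 2 = #|{: bool * ('I_nu.+1 * 'I_nu.+1)}|)%N.
  by rewrite !card_prod card_bool !card_ord expnS expn1.
apply: (@leq_card_in _ _ h) => -[i j] [i' j'].
rewrite !inE /= => /andP[_ /eqP ea] /andP[_ /eqP ea'] [eo] ei ej.
have := val_block_of (balanced_class m0 i) (balanced_class m0 j).
have := val_block_of (balanced_class m0 i') (balanced_class m0 j').
rewrite ea ea' /= eo => -> /=.
have eqE (x y : 'I_n) : (x %% m = y %% m)%N -> (x %/ m = y %/ m)%N -> x = y.
  by move=> e1 e2; apply: val_inj; rewrite /= (divn_eq x m) (divn_eq y m) e1 e2.
by case: ifP => _ [e1 e2]; congr (_, _); apply: eqE.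
Qed.

Lemma sum_block_pairs (R : realType) (m n : nat) (m0 : (0 < m)%N)
    (F : 'I_(nblocks m) -> R) :
  \sum_(i < n) \sum_(j < n)
    (if i == j then 0 else F (block_of (balanced_class m0 i) (balanced_class m0 j)))
  = \sum_a #|block_pairs n m0 a|%:R * F a.
Proof.
rewrite pair_big /=.
rewrite (eq_bigr (fun p : 'I_n * 'I_n => if p.1 != p.2 then
   F (block_of (balanced_class m0 p.1) (balanced_class m0 p.2)) else 0)); last first.
  by move=> p _; case: eqP.
rewrite -big_mkcond /= (partition_big
  (fun p => block_of (balanced_class m0 p.1) (balanced_class m0 p.2)) xpredT) //=.
apply: eq_bigr => a _; rewrite (eq_bigr (fun=> F a)); last first.
  by move=> p /andP[_ /eqP ->].
by rewrite sumr_const mulr_natl.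
Qed.

Lemma dist2_balanced (R : realType) (m n L : nat) (m0 : (0 < m)%N)
    (V W : 'I_L -> 'I_(nblocks m) -> R) :
  let C := clustering_of (fun _ : 'I_L => @balanced_class m n m0) in
  let lam V := dsbm (fun k k' l => V l (block_of k k')) C in
  let d := \sum_a \sum_l (V l a - W l a) ^+ 2 in
  (n %/ m * (n %/ m).-1)%:R * d <= dist2 (lam V) (lam W) /\
  dist2 (lam V) (lam W) <= (2 * (n %/ m).+1 ^ 2)%:R * d.
Proof.
move=> C lam d.
have -> : dist2 (lam V) (lam W) =
    \sum_a #|block_pairs n m0 a|%:R * \sum_l (V l a - W l a) ^+ 2.
  rewrite -sum_block_pairs; apply: eq_bigr => i _; apply: eq_bigr => j _.
  case: ifP => ij.
    by apply: big1 => l _; rewrite /lam !dsbm_clustering_of ij subrr expr0n.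
  by apply: eq_bigr => l _; rewrite /lam !dsbm_clustering_of ij.
have S0 a : 0 <= \sum_l (V l a - W l a) ^+ 2 :> R.
  by apply: sumr_ge0 => l _; apply: sqr_ge0.
rewrite /d !mulr_sumr; split; apply: ler_sum => a _.
  by rewrite ler_wpM2r // ler_nat card_block_pairs_ge.
by rewrite ler_wpM2r // ler_nat card_block_pairs_le.
Qed.

(** * Sparse perturbations of the connectivity *)

Lemma position_subproof (L b t : nat)
    (th : {ffun 'I_b * 'I_t -> 'I_(L %/ t)}) (aj : 'I_b * 'I_t) :
  (aj.2 * (L %/ t) + th aj < L)%N.
Proof.
have := ltn_ord (th aj); have := ltn_ord aj.2; have := leq_trunc_div L t.
move: (nat_of_ord (th aj)) (nat_of_ord aj.2) => x y.
by move: (L %/ t)%N => g; nia.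
Qed.

Section SparsePerturbation.

Context {R : realType} {L M b t : nat}.
Context (H : 'M[R]_L) (delta : R).
Context (H_adm : admissible_transform H).
Context (delta0 : 0 <= delta) (delta_le : 2 * delta * t%:R <= Num.sqrt L%:R).
Context (bM : (b <= M)%N) (t0 : (0 < t)%N) (tL : (t <= L)%N).

Let g : nat := (L %/ t)%N.

Implicit Type th : {ffun 'I_b * 'I_t -> 'I_g}.

(* [t] of the [L] coordinates, one in each of [t] intervals of length [g], carry
   the spikes of a block. *)
Definition position th aj : 'I_L := Ordinal (position_subproof th aj).

Lemma position_div th aj : (position th aj %/ g = aj.2)%N.
Proof.
have g0 : (0 < g)%N by case: (th aj) => x; apply: leq_ltn_trans.
by rewrite /= divnMDl // [(th aj %/ g)%N]divn_small ?addn0.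
Qed.

Definition spikes th (a : 'I_M) : pred 'I_L := fun k =>
  [exists aj : 'I_b * 'I_t, (aj.1 == a :> nat) && (position th aj == k)].

Lemma spikesP th (a : 'I_M) k :
  reflect (exists2 aj : 'I_b * 'I_t, aj.1 = a :> nat & position th aj = k)
          (spikes th a k).
Proof.
apply: (iffP existsP) => [[aj /andP[/eqP ? /eqP ?]]|[aj e1 e2]].
  by exists aj.
by exists aj; rewrite e1 e2 !eqxx.
Qed.

Lemma card_spikes th a : (#|spikes th a| <= (a < b) * t)%N.
Proof.
have [ab|ab] := ltnP a b; last first.
  rewrite leqn0; apply/eqP/eq_card0 => k; apply/negbTE/negP.
  rewrite -[_ \in _]/(spikes th a k) => /spikesP[aj e _].
  by move: ab; rewrite -e leqNgt ltn_ord.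
rewrite mul1n; apply: (card_slots (g := g)) => [k|k k'].
  by case/spikesP => aj _ <-; rewrite position_div.
case/spikesP => -[c j] e <- /spikesP[[c' j'] e' <-].
rewrite !position_div => /= /val_inj jj; subst j'.
have -> // : c = c' by apply: val_inj; rewrite [LHS]e [RHS]e'.
Qed.

(** The entry [sqrt L / 2] at index 0 lifts the first [b] blocks to 1/2. A spike may fall on index 0
    too, whence a sum and not a case distinction. *)
Definition coefs th k (a : 'I_M) : R :=
  (a < b)%:R * (Num.sqrt L%:R / 2 * (val k == 0%N)%:R)
  + delta * (spikes th a k)%:R.

Definition base_block (l : 'I_L) (a : 'I_M) : R := (a < b)%:R / 2.

Definition perturbed_block th l a : R := \sum_k H k l * coefs th k a.

Lemma perturbed_blockE th l a :
  perturbed_block th l a =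
  base_block l a + delta * \sum_k H k l * (spikes th a k)%:R.
Proof.
have -> : base_block l a =
    \sum_k H k l * ((a < b)%:R * (Num.sqrt L%:R / 2 * (val k == 0%N)%:R)).
  transitivity ((a < b)%:R / 2 *
     \sum_k H k l * (Num.sqrt L%:R * (val k == 0%N)%:R)).
    by rewrite admissible_const // mulr1.
  by rewrite mulr_sumr; apply: eq_bigr => k _; ring.
rewrite mulr_sumr -big_split /=.
by apply: eq_bigr => k _; rewrite /coefs; ring.
Qed.

(** On a raised block the deviation from 1/2 is at most [delta * t / sqrt L], by the bound on [H^T]
    of binary vectors, and [delta_le] makes this at most 1/2. The other blocks have no spike and
    stay at 0. *)
Lemma perturbed_block_bounds th l a : 0 <= perturbed_block th l a <= 1.
Proof.
rewrite perturbed_blockE /base_block.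
have := admissible_bound (spikes th a) l H_adm.
set x := \sum_k _ => xle.
have L0 : 0 < Num.sqrt L%:R :> R.
  by rewrite sqrtr_gt0 ltr0n; apply: leq_trans tL.
have : `|delta * x| <= (a < b)%:R / 2.
  rewrite normrM ger0_norm //.
  apply: (le_trans (ler_wpM2l delta0 xle)).
  rewrite mulrA ler_pdivrMr //.
  have h : #|spikes th a|%:R <= (a < b)%:R * t%:R :> R.
    by rewrite -natrM ler_nat card_spikes.
  apply: (le_trans (ler_wpM2l delta0 h)).
  have : 0 <= (a < b)%:R :> R by [].
  by move=> b0; have := ler_wpM2l b0 delta_le; lra.
rewrite ler_norml => /andP[h1 h2].
have : (a < b)%:R <= 1 :> R by case: (_ < _)%N.
lra.
Qed.

Lemma card_coefs th :
  (#|[set ka : 'I_L * 'I_M | coefs th ka.1 ka.2 != 0%R]%SET| <= b * t.+1)%N.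
Proof.
rewrite -sum1_card big_mkcond /=.
apply: (@leq_trans (\sum_(ka : 'I_L * 'I_M)
   ((ka.2 < b)%N * (val ka.1 == 0%N) + spikes th ka.2 ka.1))%N).
  apply: leq_sum => -[k a] _; rewrite inE /coefs /=.
  case: (spikes th a k); first by rewrite addn1; case: ifP.
  rewrite mulr0 addr0 addn0.
  case: (val k == 0%N); case: (_ < _)%N => //=; rewrite ?muln1.
  - by case: ifP.
  - by rewrite mul0r eqxx.
  - by rewrite !mulr0 eqxx.
  - by rewrite !mulr0 eqxx.
rewrite -(pair_bigA _ (fun (k : 'I_L) (a : 'I_M) =>
  (a < b)%N * (val k == 0%N) + spikes th a k))%N /=.
rewrite exchange_big /=.
apply: (@leq_trans (\sum_(a < M) (a < b)%N * t.+1)%N).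
  apply: leq_sum => a _; rewrite big_split /= mulnS leq_add //.
    rewrite -big_distrr /= -[leqRHS]muln1 leq_mul2l; apply/orP; right.
    rewrite -big_mkcond sum1_card /=.
    apply: (@card_slots L 1 1) => [k|k k']; first by move/eqP=> ->.
    by move=> /eqP e /eqP e' _; apply: val_inj; rewrite /= e e'.
  by rewrite -big_mkcond sum1_card; apply: card_spikes.
rewrite -big_distrl /= leq_mul2r; apply/orP; right.
by rewrite -big_mkcond sum1_card card_ord_lt.
Qed.

Lemma dist_perturbed_base th :
  \sum_a \sum_l (perturbed_block th l a - base_block l a) ^+ 2
  <= (b * t)%:R * delta ^+ 2.
Proof.
apply: (@le_trans _ _ (\sum_(a < M) ((a < b) * t)%:R * delta ^+ 2)).
  apply: ler_sum => a _.
  under eq_bigr => l _ do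
    rewrite perturbed_blockE [X in X ^+ 2]addrC addKr mulr_sumr.
  under eq_bigr => l _ do under eq_bigr => k _ do rewrite mulrCA.
  rewrite parseval //.
  apply: (@le_trans _ _ (#|spikes th a|%:R * delta ^+ 2)).
    rewrite -sum1_card natr_sum mulr_suml [leRHS]big_mkcond /=.
    apply: ler_sum => k _; rewrite -[_ \in _]/(spikes th a k).
    by case: (spikes th a k); rewrite /= ?mulr1 ?mul1r ?mulr0 ?expr0n.
  by rewrite ler_wpM2r ?sqr_ge0 // ler_nat card_spikes.
rewrite -mulr_suml ler_wpM2r ?sqr_ge0 // -natr_sum ler_nat -big_distrl /=.
by rewrite leq_mul2r -big_mkcond sum1_card card_ord_lt // leqnn orbT.
Qed.

(** By orthogonality the distance is read on the coefficients. Where the words differ, the spike of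
    [th] is not one of [th']: the only spike of [th'] in that interval of that block comes from the
    same index and sits elsewhere. Counting the spikes of [th] alone loses a factor 2. *)
Lemma dist_perturbed th th' :
  (hamming th th')%:R * delta ^+ 2
  <= \sum_a \sum_l (perturbed_block th l a - perturbed_block th' l a) ^+ 2.
Proof.
pose F (ak : 'I_M * 'I_L) : R :=
  (delta * (spikes th ak.1 ak.2)%:R - delta * (spikes th' ak.1 ak.2)%:R) ^+ 2.
have -> : \sum_a \sum_l
    (perturbed_block th l a - perturbed_block th' l a) ^+ 2 = \sum_ak F ak.
  rewrite -(pair_bigA _ (fun a k => F (a, k))) /=; apply: eq_bigr => a _.
  rewrite -[RHS](parseval (fun k => delta * (spikes th a k)%:R
    - delta * (spikes th' a k)%:R) H_adm); apply: eq_bigr => l _; congr (_ ^+ 2).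
  rewrite !perturbed_blockE opprD addrACA subrr add0r -mulrBr -sumrB mulr_sumr.
  by apply: eq_bigr => k _; ring.
pose h (aj : 'I_b * 'I_t) : 'I_M * 'I_L := (widen_ord bM aj.1, position th aj).
have hI : {in [pred aj | th aj != th' aj] &, injective h}.
  move=> [a j] [a' j'] _ _ [ea ej].
  have jj : j = j'.
    by apply: val_inj; rewrite -[LHS](position_div th (a, j))
         -[RHS](position_div th (a', j')) /= ej.
  by congr (_, _) => //; apply: val_inj.
apply: le_trans (sum_inj_le hI (fun=> sqr_ge0 _)).
rewrite /hamming -sum1_card natr_sum mulr_suml.
rewrite (eq_bigl (mem [pred aj | th aj != th' aj])); last by move=> aj; rewrite inE.
apply: ler_sum => -[a j] thj; rewrite mul1r /F.
have -> : spikes th (h (a, j)).1 (h (a, j)).2.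
  by apply/spikesP; exists (a, j).
have -> : spikes th' (h (a, j)).1 (h (a, j)).2 = false.
  apply/negbTE/negP => /spikesP[[a' j'] ea /(congr1 val) ej].
  have jj : j' = j.
    by apply: val_inj; rewrite -[LHS](position_div th' (a', j'))
         -[RHS](position_div th (a, j)) ej.
  have aa : a' = a by apply: val_inj.
  subst a' j'; move/eqP: thj; apply; apply: val_inj.
  by move/eqP: ej; rewrite /= eqn_add2l => /eqP.
by rewrite mulr0 subr0 mulr1.
Qed.

End SparsePerturbation.

Lemma probabilities_dsbm (R : realType) (m n L : nat) (G : tensor R m m L)
    (cls : 'I_L -> 'I_n -> 'I_m) :
  (forall k k' l, 0 <= G k k' l <= 1) ->
  probabilities (dsbm G (clustering_of cls)).
Proof.
by move=> G01 i j l; rewrite dsbm_clustering_of; case: ifP; rewrite ?lexx ?ler01.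
Qed.

Lemma attainable_sparse (R : realType) (m n n0 L s b t : nat) (H : 'M[R]_L)
    (delta : R) :
  admissible_transform H -> (0 < m)%N -> (2 * m <= n)%N ->
  (0 < b <= nblocks m)%N -> (0 < t)%N -> (2 * t <= L)%N -> (b * t.+1 <= s)%N ->
  0 < delta -> 2 * delta * t%:R <= Num.sqrt L%:R ->
  64 * ((n %/ m).+1%:R * delta) ^+ 2 <= ln (L %/ t)%:R ->
  attainable m n n0 s H
    ((n %/ m * (n %/ m).-1)%:R * delta ^+ 2 * (b * t)%:R / 64).
Proof.
move=> Hadm m0 mn /andP[b0 bM] t0 tL bts d0 dt chi Lamhat.
have tL1 : (t <= L)%N by lia.
have d0' := ltW d0.
have card_I : #|{: 'I_b * 'I_t}| = (b * t)%N by rewrite card_prod !card_ord.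
pose C := clustering_of (fun _ : 'I_L => @balanced_class m n m0).
pose G (th : {ffun 'I_b * 'I_t -> 'I_(L %/ t)}) : tensor R m m L :=
  fun k k' l => perturbed_block H delta th l (block_of k k').
pose G0 : tensor R m m L := fun k k' l => base_block (R := R) (b := b) l (block_of k k').
have nu2 : (1 < n %/ m)%N by rewrite leq_divRL.
have [] := @fano R n L ('I_b * 'I_t)%type 'I_(L %/ t) (fun th => dsbm (G th) C)
  (dsbm G0 C) ((n %/ m * (n %/ m).-1)%:R * delta ^+ 2) Lamhat.
- by rewrite card_I muln_gt0 b0.
- by rewrite card_ord leq_divRL.
- by rewrite mulr_gt0 ?exprn_gt0 // ltr0n muln_gt0; lia.
- move=> th; apply: probabilities_dsbm => k k' l.
  exact: perturbed_block_bounds.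
- apply: probabilities_dsbm => k k' l; rewrite /G0 /base_block.
  by case: (_ < _)%N => /=; apply/andP; split; lra.
- move=> th i j l; rewrite !dsbm_clustering_of; case: ifP => _; first by left.
  rewrite /G /G0; set a := block_of _ _.
  (* Blocks from [b] on carry no spike, so the family and the base agree there; the others have base
     value 1/2. *)
  have [ab|ab] := ltnP a b; last first.
    left; rewrite perturbed_blockE // big1 ?mulr0 ?addr0 // => k _.
    have := card_spikes th a; rewrite ltnNge ab leqn0 => /eqP/card0_eq /(_ k).
    by rewrite -[_ \in _]/(spikes th a k) => ->; rewrite mulr0.
  by right; rewrite /base_block ab.
- move=> th; rewrite card_I card_ord.
  have [_ h] := dist2_balanced n m0 (perturbed_block H delta th)
    (base_block (R := R) (b := b)).
  apply: (@le_trans _ _ (32 * ((2 * (n %/ m).+1 ^ 2)%:R *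
            ((b * t)%:R * delta ^+ 2)))).
    rewrite ler_pM2l //; apply: (le_trans h); rewrite ler_pM2l ?ltr0n //.
    exact: dist_perturbed_base.
  (* The 64 of [chi] is the 32 of [fano] times the 2 of [card_block_pairs_le]. *)
  rewrite natrM natrX.
  have := ler_wpM2l (ler0n R (b * t)) chi.
  by rewrite exprMn; lra.
- move=> th th'.
  have [h _] := dist2_balanced n m0 (perturbed_block H delta th)
    (perturbed_block H delta th').
  apply: le_trans h; rewrite -mulrA ler_pM2l ?ltr0n ?muln_gt0; last lia.
  by rewrite mulrC; apply: dist_perturbed.
move=> th; rewrite card_I => P; exists (G th), C; split => //.
- apply: (sparse_connectivityI (D := coefs delta th)).
  + move=> k k' l; split; last by rewrite /G block_ofC.
    exact: perturbed_block_bounds.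
  + by move=> l a; rewrite /block_entry /G block_ofK.
  + by apply: leq_trans bts; apply: card_coefs.
- apply: clustering_of_seqs => l l' _.
  rewrite (_ : [set i | _]%SET = finset.set0) ?cards0 //.
  by apply/setP => i; rewrite !inE eqxx.
- apply: probabilities_dsbm => k k' l; exact: perturbed_block_bounds.
Qed.

(** * Moving nodes between classes *)

(* A letter [Some (p, k)] puts the [p]-th node of its slot in class [k] and
   leaves the others in the default class; [None] moves no node. *)
Definition decode (g : nat) (K : finType) (x : option ('I_g * K)) (p : 'I_g) :
    option K :=
  if x is Some (q, k) then if q == p then Some k else None else None.

Lemma decode_inj (g : nat) (K : finType) (x y : option ('I_g * K)) :
  x != y -> exists p, decode x p != decode y p.
Proof.
case: x y => [[p k]|] [[q k']|] //= xy; last first.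
- by exists q; rewrite eqxx.
- by exists p; rewrite eqxx.
- exists p; rewrite eqxx; case: (q =P p) => [e|//]; apply: contra xy => /eqP[->].
  by rewrite e.
Qed.

Section ClusterPerturbation.

Context {R : realType} {m n n0 L s P sigma g w : nat} {K : finType}.
Context (H : 'M[R]_L) (delta : R) (gg : 'I_m -> 'I_m -> R).
Context (emb : option K -> 'I_m) (bcls : 'I_n -> 'I_m) (beta : 'I_m -> 'I_m).
Context (tau : 'I_L -> option 'I_P).

Context (H_adm : admissible_transform H).
Context (P0 : (0 < P)%N) (sigma0 : (0 < sigma)%N) (g0 : (0 < g)%N).
Context (w0 : (0 < w)%N) (K0 : (0 < #|K|)%N) (sgn : (sigma * g <= n./2)%N).
Context (delta0 : 0 < delta).
Context (gg01 : forall k k', 0 <= gg k k' <= 1).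
Context (ggC : forall k k', gg k k' = gg k' k).
Context (gg_supp :
  (#|[set a : 'I_(nblocks m) | block_entry gg a != 0%R]%SET| <= s)%N).
Context (beta_emb : forall o, beta (emb o) = emb None).
Context (beta_bcls : forall i : 'I_n, (n./2 <= i)%N -> beta (bcls i) = bcls i).
Context (gg_beta : forall x y, gg x y = gg (beta x) (beta y) \/
  gg (beta x) (beta y) = 1 / 2 /\ `|gg x y - 1 / 2| <= delta).
Context (gg_sep : forall o o', o != o' ->
  (n <= 8 * #|[set i : 'I_n | (n./2 <= i)%N &
          (delta <= `|gg (emb o) (bcls i) - gg (emb o') (bcls i)|)%R]%SET|)%N).
Context (tau_fiber : forall p, #|[set l | tau l == Some p]%SET| = w).
Context (tau_step : forall l l' : 'I_L, l' = l.+1 :> nat ->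
  tau l = tau l' \/ (sigma <= n0)%N /\ (tau l = None \/ tau l' = None)).
Context (chi : 64 * (n%:R * w%:R * delta ^+ 2) <= ln (g * #|K|).+1%:R :> R).

Implicit Type th : {ffun 'I_P * 'I_sigma -> option ('I_g * K)}.

(** The nodes below [sigma * g] form [sigma] slots of [g] consecutive nodes. Row [p] of the word
    governs the [w] times with [tau l = Some p]; at times with [tau l = None], and beyond the slots,
    every node is at rest. *)
Definition state th (l : 'I_L) (i : 'I_n) : option K :=
  if tau l is Some p then
    if (insub (i %/ g)%N : option 'I_sigma) is Some j then
      if (insub (i %% g)%N : option 'I_g) is Some q then decode (th (p, j)) q
      else None
    else None
  else None.

Definition classes_at th (l : 'I_L) (i : 'I_n) : 'I_m :=
  if (i < n./2)%N then emb (state th l i) else bcls i.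

Definition base_class (i : 'I_n) : 'I_m :=
  if (i < n./2)%N then emb None else bcls i.

Definition moved th l : pred 'I_n := fun i => state th l i != None.

Lemma slot_subproof (j : 'I_sigma) (q : 'I_g) : (j * g + q < n./2)%N.
Proof.
apply: leq_trans sgn; have := ltn_ord j; have := ltn_ord q.
by move: (nat_of_ord j) (nat_of_ord q) => x y hy hx; nia.
Qed.

Lemma slot_subproof2 (j : 'I_sigma) (q : 'I_g) : (j * g + q < n)%N.
Proof.
apply: leq_trans (slot_subproof j q) _.
by rewrite leq_half_double leqW // -addnn leq_addr.
Qed.

Definition slot j q : 'I_n := Ordinal (slot_subproof2 j q).

Lemma slot_div (j : 'I_sigma) (q : 'I_g) : (slot j q %/ g = j)%N.
Proof. by rewrite /= divnMDl // [(q %/ g)%N]divn_small ?addn0. Qed.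

Lemma state_slot th l p j q :
  tau l = Some p -> state th l (slot j q) = decode (th (p, j)) q.
Proof.
move=> tl; rewrite /state tl.
have -> : insub (slot j q %/ g)%N = Some j by rewrite slot_div valK.
by have -> : insub (slot j q %% g)%N = Some q
  by rewrite /= modnMDl modn_small // valK.
Qed.

(** A letter names at most one node, so a slot has at most one moved node. *)
Lemma card_moved th l : (#|moved th l| <= (tau l != None) * sigma)%N.
Proof.
case tl: (tau l) => [p|] /=; last first.
  rewrite leqn0; apply/eqP/eq_card0 => i.
  by rewrite -[LHS]/(moved th l i) /moved /state tl.
rewrite mul1n; apply: (card_slots (g := g)) => [i|i i'].
  by rewrite /moved /state tl; case: insubP.
rewrite /moved /state tl; case: insubP => // j _ ej; case: insubP => // q _ eq.
move=> di; case: insubP => // j' _ ej'; case: insubP => // q' _ eq'.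
move=> di' ee; have jj : j' = j by apply: val_inj; rewrite ej ej' ee.
have : q = q'.
  move: di di'; rewrite jj /decode; case: (th (p, j)) => [[x k]|] //=.
  by case: (x =P q) => // <-; case: (x =P q') => // <-.
move=> qq; apply: val_inj; rewrite /= (divn_eq i g) (divn_eq i' g) ee.
by rewrite -eq -eq' qq.
Qed.

Lemma classes_at_unmoved th l i : ~~ moved th l i -> classes_at th l i = base_class i.
Proof. by move=> /negPn /eqP h; rewrite /classes_at /base_class h. Qed.

Lemma beta_classes_at th l i : beta (classes_at th l i) = base_class i.
Proof.
rewrite /classes_at /base_class; case: ltnP => // h; exact: beta_bcls.
Qed.

Lemma sum_fibers (f : option 'I_P -> R) :
  f None = 0 -> \sum_l f (tau l) = w%:R * \sum_p f (Some p).
Proof.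
move=> f0; transitivity (\sum_l \sum_p (tau l == Some p)%:R * f (Some p)).
  apply: eq_bigr => l _; case: (tau l) => [p|].
    rewrite (bigD1 p) //= eqxx mul1r big1 ?addr0 // => q qp.
    by rewrite (_ : (Some p == Some q) = (p == q)) // eq_sym (negPf qp) mul0r.
  by rewrite f0 big1 // => p _; rewrite mul0r.
rewrite exchange_big mulr_sumr /=; apply: eq_bigr => p _.
rewrite -mulr_suml -(tau_fiber p) -sum1_card natr_sum.
congr (_ * _); rewrite [RHS]big_mkcond; apply: eq_bigr => l _.
by rewrite inE; case: (_ == _).
Qed.

Definition cluster_lam (cls : 'I_L -> 'I_n -> 'I_m) : tensor R n n L :=
  dsbm (fun k k' _ => gg k k') (clustering_of cls).

(** An entry changes only if one of its two nodes is moved, and then by at most [delta]. There are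
    [w * P] times with moves, at most [sigma] moved nodes at each, and a node meets at most [2 n]
    entries. *)
Lemma dist_cluster_base th :
  dist2 (cluster_lam (classes_at th)) (cluster_lam (fun=> base_class))
  <= 2 * (n%:R * (w%:R * P%:R * sigma%:R)) * delta ^+ 2.
Proof.
apply: (@le_trans _ _ (\sum_i \sum_j \sum_l
    ((moved th l i)%:R + (moved th l j)%:R) * delta ^+ 2)).
  apply: ler_sum => i _; apply: ler_sum => j _; apply: ler_sum => l _.
  rewrite /cluster_lam !dsbm_clustering_of; case: ifP => _.
    by rewrite subrr expr0n mulr_ge0 ?sqr_ge0 // addr_ge0.
  have le1 : (gg (classes_at th l i) (classes_at th l j) -
      gg (base_class i) (base_class j)) ^+ 2 <= delta ^+ 2.
    rewrite -!(beta_classes_at th l).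
    have [->|[-> h]] := gg_beta (classes_at th l i) (classes_at th l j).
      by rewrite subrr expr0n sqr_ge0.
    rewrite -real_normK ?num_real //.
    by rewrite ler_pXn2r ?nnegrE // ltW.
  case mi: (moved th l i); case mj: (moved th l j); last first.
    rewrite !classes_at_unmoved ?mi ?mj // subrr expr0n /=.
    by rewrite addr0 mul0r.
  1-3: apply: (le_trans le1); apply: ler_peMl; first exact: sqr_ge0.
  1-3: by rewrite -natrD ler1n.
have sum_moved : \sum_i \sum_l (moved th l i)%:R <= w%:R * P%:R * sigma%:R :> R.
  rewrite exchange_big /=.
  apply: (@le_trans _ _ (\sum_l (if tau l is Some _ then sigma%:R else 0))).
    apply: ler_sum => l _; rewrite -natr_sum -big_mkcond sum1_card.
    apply: le_trans (_ : ((tau l != None) * sigma)%:R <= _).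
      by rewrite ler_nat card_moved.
    by case: (tau l) => [p|]; rewrite ?mul1n ?mul0n.
  rewrite (sum_fibers (f := fun o => if o is Some _ then sigma%:R else 0)) //.
  by rewrite sumr_const card_ord -(mulr_natl sigma%:R P) mulrA.
pose A i := \sum_l (moved th l i)%:R : R.
have -> : \sum_i \sum_j \sum_l
    ((moved th l i)%:R + (moved th l j)%:R) * delta ^+ 2
    = 2 * (n%:R * \sum_i A i) * delta ^+ 2.
  transitivity (\sum_i \sum_j (A i + A j) * delta ^+ 2).
    apply: eq_bigr => i _; apply: eq_bigr => j _.
    by rewrite -mulr_suml big_split.
  under eq_bigr => i _ do
    rewrite -mulr_suml big_split /= sumr_const card_ord -(mulr_natl (A i) n).
  rewrite -mulr_suml big_split /= -mulr_sumr sumr_const card_ord.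
  by rewrite -(mulr_natl (\sum_i A i) n); ring.
by rewrite ler_wpM2r ?sqr_ge0 // ler_pM2l // ler_wpM2l.
Qed.

(** A position where the words differ yields, at each of the [w] times of its row, a node of the
    slot in two different states. By [gg_sep] at least an eighth of the nodes, all of them fixed,
    see this through their links, and distinct slots give distinct rows of the tensor. *)
Lemma dist_cluster th th' :
  n%:R * w%:R / 8 * delta ^+ 2 * (hamming th th')%:R
  <= dist2 (cluster_lam (classes_at th)) (cluster_lam (classes_at th')).
Proof.
pose pos pj : 'I_g := odflt (Ordinal g0)
  [pick q | decode (th pj) q != decode (th' pj) q].
have posP pj : th pj != th' pj ->
    decode (th pj) (pos pj) != decode (th' pj) (pos pj).
  move=> /decode_inj[q hq]; rewrite /pos.
  by case: pickP => [//|/(_ q)]; rewrite hq.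
pose A : pred ('I_L * 'I_sigma) := fun lj =>
  if tau lj.1 is Some p then th (p, lj.2) != th' (p, lj.2) else false.
pose h (lj : 'I_L * 'I_sigma) : 'I_L * 'I_n :=
  (lj.1, if tau lj.1 is Some p then slot lj.2 (pos (p, lj.2))
         else slot lj.2 (Ordinal g0)).
pose Lt := cluster_lam (classes_at th); pose Lt' := cluster_lam (classes_at th').
pose F (li : 'I_L * 'I_n) : R :=
  \sum_j (Lt li.2 j li.1 - Lt' li.2 j li.1) ^+ 2.
have -> : dist2 Lt Lt' = \sum_li F li.
  rewrite -(pair_bigA _ (fun l i => F (l, i))) /= exchange_big.
  by apply: eq_bigr => i _; rewrite exchange_big.
have hI : {in A &, injective h}.
  move=> [l j] [l' j'] _ _ [<-] e; congr (_, _); apply: val_inj.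
  by case: (tau l) e => [p|] /(congr1 (fun i : 'I_n => i %/ g)%N);
    rewrite !slot_div.
apply: le_trans (sum_inj_le hI _); last first.
  by move=> li; apply: sumr_ge0 => j _; apply: sqr_ge0.
have sumA : \sum_(lj in A) (n%:R / 8 * delta ^+ 2) =
    n%:R * w%:R / 8 * delta ^+ 2 * (hamming th th')%:R.
  pose f (o : option 'I_P) : R := if o is Some p then
    \sum_j (th (p, j) != th' (p, j))%:R else 0.
  rewrite (_ : _ * (hamming th th')%:R =
     (n%:R / 8 * delta ^+ 2) * (w%:R * \sum_p f (Some p))); last first.
    rewrite /f pair_bigA /= /hamming -sum1_card natr_sum big_mkcond /=.
    rewrite (eq_bigr (fun pj => (th pj != th' pj)%:R)); last first.
      by move=> pj _; rewrite inE; case: (_ != _).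
    rewrite [in RHS](eq_bigr (fun pj => (th pj != th' pj)%:R)); last by case.
    by ring.
  rewrite -sum_fibers // mulr_sumr big_mkcond /=.
  rewrite -(pair_bigA _ (fun l j => if (l, j) \in A then _ else _)) /=.
  apply: eq_bigr => l _; rewrite /f.
  under eq_bigr => j _ do rewrite -[_ \in _]/(A (l, j)) /A /=.
  case: (tau l) => [p|]; last by rewrite big1 ?mulr0.
  by rewrite mulr_sumr; apply: eq_bigr => j _; case: ifP; rewrite ?mulr1 ?mulr0.
rewrite -sumA; apply: ler_sum => -[l j].
rewrite -[_ \in _]/(A (l, j)) /A /= /h /F /=.
case tl: (tau l) => [p|//] thp.
set q := pos (p, j); set i := slot j q.
have iv : (i < n./2)%N by apply: slot_subproof.
have st : state th l i != state th' l i.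
  by rewrite !(state_slot _ _ _ tl); apply: posP.
have := gg_sep st; set S := [set _ | _]%SET => nS.
apply: (@le_trans _ _ (\sum_(k in S) delta ^+ 2)).
  rewrite sumr_const -[leRHS]mulr_natl ler_wpM2r ?sqr_ge0 // ler_pdivrMr //.
  by rewrite mulrC -natrM ler_nat.
rewrite big_mkcond; apply: ler_sum => k _; case: ifP => [|_]; last exact: sqr_ge0.
rewrite inE => /andP[vk dk].
rewrite /Lt /Lt' /cluster_lam !dsbm_clustering_of.
case: eqP => [ik|_]; first by move: iv; rewrite ik ltnNge vk.
rewrite /classes_at iv ltnNge vk /=.
rewrite -[leRHS]real_normK ?num_real //.
by rewrite ler_pXn2r ?nnegrE // ltW.
Qed.

Lemma attainable_cluster :
  attainable m n n0 s H
    (n%:R * w%:R / 8 * delta ^+ 2 * (P * sigma)%:R / 64).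
Proof.
move=> Lamhat.
have card_I : #|{: 'I_P * 'I_sigma}| = (P * sigma)%N.
  by rewrite card_prod !card_ord.
have card_A : #|{: option ('I_g * K)}| = (g * #|K|).+1.
  by rewrite card_option card_prod card_ord.
have n_gt0 : (0 < n)%N by have := sgn; have := g0; have := sigma0; nia.
have [] := @fano R n L ('I_P * 'I_sigma)%type (option ('I_g * K))
  (fun th => cluster_lam (classes_at th)) (cluster_lam (fun=> base_class))
  (n%:R * w%:R / 8 * delta ^+ 2) Lamhat.
- by rewrite card_I muln_gt0 P0.
- by rewrite card_A ltnS muln_gt0 g0.
- by rewrite mulr_gt0 ?exprn_gt0 // divr_gt0 // mulr_gt0 // ltr0n.
- by move=> th; apply: probabilities_dsbm.
- exact: probabilities_dsbm.
- move=> th i j l; rewrite /cluster_lam !dsbm_clustering_of.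
  case: ifP => _; first by left.
  rewrite -!(beta_classes_at th l).
  by case: (gg_beta (classes_at th l i) (classes_at th l j)) => [|[]]; [left|right].
- move=> th; rewrite card_I card_A.
  have h := ler_wpM2l (ler0n R (P * sigma)) chi.
  apply: le_trans h; have := dist_cluster_base th; rewrite natrM; lra.
- exact: dist_cluster.
move=> th; rewrite card_I => Pr.
exists (fun k k' _ => gg k k'), (clustering_of (classes_at th)); split => //.
(* [G] is constant in time, so its coefficients all sit at index 0 and are as many as the nonzero
   blocks. *)
- apply: (sparse_connectivityI (D := fun k a =>
     Num.sqrt L%:R * (val k == 0%N)%:R * block_entry gg a)).
  + by move=> k k' l.
  + move=> l a; rewrite -[LHS]mul1r -[X in X * _](admissible_const l H_adm).
    by rewrite mulr_suml; apply: eq_bigr => k _; rewrite !mulrA.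
  + apply: leq_trans gg_supp; set S := [set ka | _]%SET.
    have SP ka : ka \in S -> val ka.1 = 0%N /\ block_entry gg ka.2 != 0.
      rewrite inE; case: (val ka.1 =P 0%N) => [->|_].
        by rewrite mulf_eq0 negb_or => /andP[].
      by rewrite mulr0 mul0r eqxx.
    have snd_inj : {in S &, injective (fun ka : 'I_L * 'I_(nblocks m) => ka.2)}.
      move=> [k a] [k' a'] /SP[/= k0 _] /SP[/= k0' _] ->.
      by congr (_, _); apply: val_inj; rewrite /= k0 k0'.
    rewrite -(card_in_imset snd_inj); apply: subset_leq_card.
    by apply/fintype.subsetP => _ /imsetP[ka /SP[_ h] ->]; rewrite inE.
- apply: clustering_of_seqs => l l' ll'.
  have [tt|[sn hn]] := tau_step ll'.
    rewrite (_ : [set i | _]%SET = finset.set0) ?cards0 //.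
    by apply/setP => i; rewrite !inE /classes_at /state tt eqxx.
  apply: leq_trans sn.
  (* If [tau] changes between two consecutive times, one of them is at rest, so only nodes moved at
     the other one change class. *)
  have cards l1 l2 : tau l2 = None ->
     (#|[set i | classes_at th l1 i != classes_at th l2 i]%SET| <= sigma)%N.
    move=> t2; apply: leq_trans (_ : (tau l1 != None) * sigma <= _)%N; last first.
      by case: (_ != _); rewrite ?mul1n.
    apply: leq_trans (card_moved th l1); apply: subset_leq_card.
    apply/fintype.subsetP => i; rewrite inE -[_ \in moved _ _]/(moved th l1 i).
    apply: contraR => um; rewrite classes_at_unmoved // classes_at_unmoved //.
    by rewrite /moved /state t2.
  case: hn => [t1|]; last exact: cards.
  rewrite (_ : [set i | _]%SET =
    [set i | classes_at th l' i != classes_at th l i]%SET); first exact: cards.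
  by apply/setP => i; rewrite !inE eq_sym.
- exact: probabilities_dsbm.
Qed.

End ClusterPerturbation.

(** * Codes separating the classes *)

(* [rho] classes, [emb None] being the default one, can be told apart by their
   links to the fixed half of the nodes, and moving a node out of the default
   class only alters entries equal to 1/2 ([beta] undoes the moves). *)
Definition cluster_code (R : realType) (m n s rho : nat) (delta : R) : Prop :=
  exists (K : finType) (gg : 'I_m -> 'I_m -> R) (emb : option K -> 'I_m)
         (bcls : 'I_n -> 'I_m) (beta : 'I_m -> 'I_m),
  ((0 < #|K|)%N /\ #|K|.+1 = rho) /\
  (forall k k', 0 <= gg k k' <= 1) /\
  (forall k k', gg k k' = gg k' k) /\
  (#|[set a : 'I_(nblocks m) | block_entry gg a != 0%R]%SET| <= s)%N /\
  (forall o, beta (emb o) = emb None) /\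
  (forall i : 'I_n, (n./2 <= i)%N -> beta (bcls i) = bcls i) /\
  (forall x y, gg x y = gg (beta x) (beta y) \/
     gg (beta x) (beta y) = 1 / 2 /\ `|gg x y - 1 / 2| <= delta) /\
  (forall o o', o != o' ->
     (n <= 8 * #|[set i : 'I_n | (n./2 <= i)%N &
        (delta <= `|gg (emb o) (bcls i) - gg (emb o') (bcls i)|)%R]%SET|)%N).

Lemma shift_subproof (n v k : nat) (y : 'I_k) (p : 'I_((n - v) %/ k)) :
  (v + (p * k + y) < n)%N.
Proof.
have := ltn_ord p; have := ltn_ord y; have := leq_trunc_div (n - v) k.
move: (nat_of_ord p) (nat_of_ord y) => a b; move: (_ %/ _)%N => d; nia.
Qed.

Lemma card_shifted_mod (n v k : nat) (D : pred nat) :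
  ((n - v) %/ k * #|[set y : 'I_k | D y]%SET|
   <= #|[set i : 'I_n | (v <= i)%N & D ((i - v) %% k)]%SET|)%N.
Proof.
pose h (yp : 'I_k * 'I_((n - v) %/ k)) : 'I_n :=
  Ordinal (shift_subproof yp.1 yp.2).
have hK yp : (h yp - v = yp.2 * k + yp.1)%N by rewrite /= addKn.
have hm yp : ((h yp - v) %% k = yp.1)%N by rewrite hK modnMDl modn_small.
have hI : injective h.
  move=> yp yp' e; have e1 : yp.1 = yp'.1 by apply: val_inj; rewrite -[LHS]hm -[RHS]hm e.
  have k0 : (0 < k)%N by case: (yp.1) => x; apply: leq_ltn_trans.
  have e2 : yp.2 = yp'.2.
    apply: val_inj; have := congr1 (fun i : 'I_n => (i - v) %/ k)%N e.
    by rewrite !hK !divnMDl // ![(nat_of_ord _ %/ k)%N]divn_small ?addn0.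
  by case: yp yp' e1 e2 {e} => [? ?] [? ?] /= -> ->.
have <- : #|(h @: finset.setX [set y : 'I_k | D y]%SET [set: 'I__])%SET| =
    ((n - v) %/ k * #|[set y : 'I_k | D y]%SET|)%N.
  by rewrite card_imset // cardsX cardsT card_ord mulnC.
apply: subset_leq_card; apply/fintype.subsetP => _ /imsetP[yp yD ->].
move: yD; rewrite !inE andbT => yD.
by rewrite hm yD andbT /= leq_addr.
Qed.

(** Classes [0..k] are codewords, classes [k+1..2k] are columns, and only links between the two
    sides are nonzero, which costs [k (k + 1)] coefficients. The zero codeword is the default class,
    so undoing the moves brings all these links back to 1/2. *)
Lemma cluster_code_bipartite (R : realType) (m n s k : nat)
    (c : nat -> nat -> bool) (delta : R) :
  (0 < k)%N -> (k.*2 < m)%N -> (k * k.+1 <= s)%N -> (2 * m <= n)%N ->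
  (forall y, c 0%N y = false) ->
  (forall x x', (x <= k)%N -> (x' <= k)%N -> x != x' ->
     (k <= 2 * #|[set y : 'I_k | c x y != c x' y]%SET|)%N) ->
  0 < delta <= 1 / 2 ->
  cluster_code m n s k.+1 delta.
Proof.
move=> k0 km ks mn c0 csep /andP[d0 d2].
have m0 : (0 < m)%N by lia.
pose bip (x y : 'I_m) := [&& x <= k, k < y & y <= k.*2]%N.
pose gg (x y : 'I_m) : R :=
  if bip x y then 1 / 2 + delta * (c x (y - k.+1)%N)%:R
  else if bip y x then 1 / 2 + delta * (c y (x - k.+1)%N)%:R else 0.
have emb_lt (o : option 'I_k) : ((if o is Some x then x.+1 else 0) < m)%N.
  by case: o => [x|] //; have := ltn_ord x; lia.
pose emb (o : option 'I_k) : 'I_m := Ordinal (emb_lt o).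
have embk o : (emb o <= k)%N by case: o => [x|] /=.
have bcls_lt (i : 'I_n) : (k.+1 + (i - n./2) %% k < m)%N.
  by have := @ltn_pmod (i - n./2) k k0; lia.
pose bcls i : 'I_m := Ordinal (bcls_lt i).
pose beta (x : 'I_m) : 'I_m := if (x <= k)%N then emb None else x.
have betak x : (beta x <= k)%N = (x <= k)%N by rewrite /beta; case: ifP.
have bip_beta x y : bip (beta x) (beta y) = bip x y.
  rewrite /bip betak ltnNge betak -ltnNge; congr (_ && _).
  by rewrite /beta; case: leqP.
have bipC x y : bip x y -> bip y x = false.
  by rewrite /bip => /and3P[h1 h2 h3]; rewrite leqNgt h2.
have bipE x y : bip x y -> gg x y = 1 / 2 + delta * (c x (y - k.+1)%N)%:R.
  by rewrite /gg => ->.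
have ggC x y : gg x y = gg y x.
  by rewrite /gg; case: ifP => // /bipC ->.
exists 'I_k, gg, emb, bcls, beta; split; first by rewrite card_ord.
split.
  move=> x y; apply/andP; rewrite /gg.
  case: ifP => _; first by case: (c _ _) => /=; split; lra.
  by case: ifP => _; [case: (c _ _) => /=; split; lra|split; lra].
split=> //.
split.
  apply: leq_trans ks.
  have pos (a : 'I_(nblocks m)) : block_entry gg a != 0 ->
      bip (val (enum_val a)).1 (val (enum_val a)).2.
    rewrite /block_entry /gg; case: ifP => // _; case: ifP; rewrite ?eqxx //.
    move=> /and3P[h1 h2 h3] _.
    by have := leq_trans h2 (leq_trans (valP (enum_val a)) h1); rewrite ltnn.
  pose h (a : 'I_(nblocks m)) : 'I_k.+1 * 'I_k.+1 :=
    (inord (val (enum_val a)).1, inord ((val (enum_val a)).2 - k.+1)).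
  have -> : (k * k.+1 = #|finset.setX [set: 'I_k.+1] (~: [set ord_max : 'I_k.+1])|)%N.
    by rewrite cardsX cardsT cardsC1 !card_ord mulnC.
  set S := [set a | _]%SET.
  have hI : {in S &, injective h}.
    move=> a a'; rewrite !inE => /pos /and3P[h1 h2 h3] /pos /and3P[h1' h2' h3'].
    move=> [/(congr1 val) /= e1 /(congr1 val) /= e2].
    have lt y : (y <= k.*2)%N -> (y - k.+1 < k.+1)%N by lia.
    rewrite !inordK ?lt // in e1 e2.
    apply: enum_val_inj; apply: val_inj; move: e1 e2 h2 h2' => /=.
    case: (val (enum_val a)) (val (enum_val a')) => [x y] [x' y'] /= e1 e2 h2 h2'.
    by congr (_, _); apply: val_inj => //=; lia.
  rewrite -(card_in_imset hI); apply: subset_leq_card.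
  apply/fintype.subsetP => _ /imsetP[a aS ->].
  move: aS; rewrite !inE => /pos /and3P[h1 h2 h3] /=.
  by rewrite -val_eqE /= inordK; move: h2 h3 => /=; lia.
split; first by move=> o; rewrite /beta embk.
split; first by move=> i _; rewrite /beta /= leqNgt ltn_addr.
split.
  move=> x y.
  have main x' y' : bip x' y' ->
      gg (beta x') (beta y') = 1 / 2 /\ `|gg x' y' - 1 / 2| <= delta.
    move=> b; rewrite !bipE ?bip_beta //; split.
      have /and3P[h1 _ _] := b; rewrite /beta h1 /= c0 mulr0 addr0 //.
    rewrite addrAC subrr add0r normrM (ger0_norm (ltW d0)).
    by case: (c _ _); rewrite ?normr1 ?normr0 ?mulr1 ?mulr0 // ltW.
  case bxy: (bip x y); first by right; apply: main.
  case byx: (bip y x).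
    by right; rewrite (ggC (beta x)) (ggC x); apply: main.
  by left; rewrite /gg !bip_beta bxy byx.
move=> o o' oo.
have eo : nat_of_ord (emb o) != nat_of_ord (emb o').
  apply: contra oo => /eqP; case: o o' => [x|] [x'|] //= [e].
  by apply/eqP; congr Some; apply: val_inj.
have bipb o1 i : bip (emb o1) (bcls i).
  rewrite /bip embk /= ltn_addr //=.
  by have := @ltn_pmod (i - n./2) k k0; lia.
have h1 := csep _ _ (embk o) (embk o') eo.
have h2 := card_shifted_mod n n./2 k
  (fun y => c (emb o) y != c (emb o') y).
set S := [set i : 'I_n | _ & _]%SET in h2; set T := [set i | _]%SET.
have ST : (#|S| <= #|T|)%N.
  apply: subset_leq_card; apply/fintype.subsetP => i; rewrite !inE.
  case/andP=> -> /=; rewrite !bipE // [(_ - k.+1)%N]addKn.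
  rewrite opprD addrACA subrr add0r.
  case: (c _ _); case: (c _ _) => //= _.
    by rewrite mulr1 mulr0 subr0 ler_norm.
  by rewrite mulr1 mulr0 sub0r normrN ler_norm.
apply: leq_trans (_ : 8 * #|S| <= _)%N; last by rewrite leq_mul2l ST orbT.
set D := #|_| in h1 h2.
(* The second half of the nodes contains a full period, so full periods cover at least half of it;
   at least half of the columns separate. With the halving of [n] itself, three factors 2 make the
   8. *)
have hd := divn_eq (n - n./2) k; have hr := @ltn_pmod (n - n./2) k k0.
have hn : (n <= 2 * (n - n./2))%N by have := odd_double_half n; case: odd; lia.
move: h2 hd hr; set d := (_ %/ k)%N; set r := (_ %% k)%N => h2 hd hr.
have : (n - n./2 <= 2 * (d * k))%N by lia.
have : (d * k <= 2 * (d * D))%N by nia.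
lia.
Qed.

(** Two classes leave no room for the bipartite code. All fixed nodes lie in class 0 and each of
    them sees a move to class 1; the three blocks are nonzero, hence [3 <= s]. *)
Lemma cluster_code_two (R : realType) (n s : nat) (delta : R) :
  (3 <= s)%N -> (2 * 2 <= n)%N -> 0 < delta <= 1 / 2 ->
  cluster_code 2 n s 2 delta.
Proof.
move=> s3 n4 /andP[d0 d2].
pose gg (x y : 'I_2) : R := if x == y then 1 / 2 else 1 / 2 + delta.
exists unit, gg, (fun o => if o is Some _ then ord_max else ord0),
  (fun=> ord0), (fun=> ord0).
split; first by rewrite card_unit.
split; first by move=> x y; apply/andP; rewrite /gg; case: ifP; split; lra.
split; first by move=> x y; rewrite /gg eq_sym.
split.
  by apply: leq_trans s3; apply: leq_trans (max_card _) _; rewrite card_ord card_block.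
do 2!(split => //).
split.
  move=> x y; right; split; first by rewrite /gg eqxx.
  rewrite /gg; case: ifP => _; first by rewrite subrr normr0 ltW.
  by rewrite addrAC subrr add0r gtr0_norm.
move=> o o' oo.
have h := card_shifted_mod n n./2 1 predT.
apply: (@leq_trans (8 * (n - n./2))%N).
  by have := odd_double_half n; case: odd; lia.
rewrite leq_mul2l /=; move: h; rewrite divn1.
rewrite (_ : [set y : 'I_1 | _]%SET = finset.setT); last by apply/setP => ?; rewrite !inE.
rewrite cardsT card_ord muln1 => h; apply: leq_trans h _.
apply: subset_leq_card; apply/fintype.subsetP => i; rewrite !inE.
move=> /andP[-> _] /=; move: oo.
case: o o' => [[]|] [[]|] //= _; rewrite /gg eqxx /=.
  by rewrite addrAC subrr add0r ler_norm.
by rewrite opprD addrA subrr sub0r normrN ler_norm.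
Qed.

(* Dot product over the field with two elements; its table is the Walsh code. *)
Definition dotb (r : nat) (a b : {ffun 'I_r -> bool}) : bool :=
  \big[addb/false]_i (a i && b i).

Definition toggle (r : nat) (z : 'I_r) (b : {ffun 'I_r -> bool}) :=
  [ffun i => b i (+) (i == z)].

Lemma dotb_toggle (r : nat) z (a b : {ffun 'I_r -> bool}) :
  dotb a (toggle z b) = dotb a b (+) a z.
Proof.
rewrite /dotb (eq_bigr (fun i => (a i && b i) (+) (a i && (i == z)))).
  rewrite big_split /=; congr (_ (+) _).
  rewrite (bigD1 z) //= eqxx andbT big1 ?addbF // => i iz.
  by rewrite (negPf iz) andbF.
by move=> i _; rewrite ffunE andb_addr.
Qed.

(** At an index [z] where [a] and [a'] differ, toggling [b] at [z] turns agreement into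
    disagreement, so disagreements are at least as many. *)
Lemma card_dotb_neq (r : nat) (a a' : {ffun 'I_r -> bool}) :
  a != a' -> (2 ^ r <= 2 * #|[set b | dotb a b != dotb a' b]%SET|)%N.
Proof.
move=> aa; have [z az] : exists z, a z != a' z.
  apply/existsP; apply: contraR aa; rewrite negb_exists => /forallP h.
  by apply/eqP/ffunP => i; apply/eqP/negPn.
set S := [set b | _]%SET.
have tK : involutive (@toggle r z).
  by move=> b; apply/ffunP => i; rewrite !ffunE -addbA addbb addbF.
have -> : (2 ^ r = #|S| + #|~: S|)%N.
  by rewrite cardsC card_ffun card_bool card_ord.
rewrite mul2n -addnn leq_add2l -(card_imset _ (inv_inj tK)).
apply: subset_leq_card; apply/fintype.subsetP => _ /imsetP[b + ->].
rewrite !inE negbK !dotb_toggle => /eqP ->.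
by move: az; case: (a z); case: (a' z); case: (dotb a' b).
Qed.

(** Codewords are indexed by all binary words, the zero word first. The columns omit the zero word,
    which separates nothing; codewords and columns together take [2^(r+1) - 1] classes. *)
Lemma cluster_code_walsh (R : realType) (m n s r : nat) (delta : R) :
  (0 < r)%N -> (2 ^ r.+1 <= m.+1)%N -> (2 ^ r * (2 ^ r).-1 <= s)%N ->
  (2 * m <= n)%N -> 0 < delta <= 1 / 2 ->
  cluster_code m n s (2 ^ r) delta.
Proof.
move=> r0 rm rs mn dd.
pose zero : {ffun 'I_r -> bool} := [ffun=> false].
pose ws := zero :: rem zero (enum {: {ffun 'I_r -> bool}}).
pose word x := nth zero ws x.
have r2 : (1 < 2 ^ r)%N by rewrite -{1}(expn0 2) ltn_exp2l.
have ws_perm : perm_eq (enum {: {ffun 'I_r -> bool}}) ws.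
  by apply: perm_to_rem; rewrite mem_enum.
have ws_uniq : uniq ws by rewrite -(perm_uniq ws_perm) enum_uniq.
have ws_size : size ws = (2 ^ r)%N.
  by rewrite -(perm_size ws_perm) -cardE card_ffun card_bool card_ord.
have -> : (2 ^ r = (2 ^ r).-1.+1)%N by lia.
apply: (@cluster_code_bipartite _ _ _ _ _
  (fun x y => dotb (word x) (word y.+1))) => //.
- by lia.
- by move: rm; rewrite expnS; lia.
- by rewrite prednK 1?mulnC //; lia.
- move=> y; rewrite /dotb big1 // => i _.
  by rewrite /word /= ffunE.
move=> x x' xr x'r xx.
have ww : word x != word x' by rewrite nth_uniq // ws_size; lia.
have := card_dotb_neq ww; set S := [set b | _]%SET; set T := [set y | _]%SET.
suff : (#|S| <= #|T|)%N by lia.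
have Timg : S \subset [set word (y : 'I__).+1 | y in T]%SET.
  apply/fintype.subsetP => b; rewrite inE => bS.
  have : b \in ws by rewrite -(perm_mem ws_perm) mem_enum.
  move=> /(nthP zero)[[|y] yw yb].
    move: bS; rewrite -yb /= /dotb !big1 //; by move=> i _; rewrite ffunE andbF.
  have yl : (y < (2 ^ r).-1)%N by move: yw; rewrite ws_size; lia.
  apply/imsetP; exists (Ordinal yl) => //.
  by rewrite inE /=; move: bS; rewrite -yb.
by apply: leq_trans (subset_leq_card Timg) (leq_imset_card _ _).
Qed.

(** * Rates *)

Lemma ln_le_subr1 (R : realType) (x : R) : 0 < x -> ln x <= x - 1.
Proof.
move=> x0; have -> : ln x = ln (1 + (x - 1)) by congr ln; ring.
by apply: le_ln1Dx; lra.
Qed.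

Lemma ln2_ge_half (R : realType) : 1 / 2 <= ln 2 :> R.
Proof.
have h : ln (2^-1) <= 2^-1 - 1 :> R by apply: ln_le_subr1; lra.
by rewrite lnV ?posrE in h; lra.
Qed.

(** * Clustering terms of the rate *)

Lemma attainable_code (R : realType) (m n n0 L s P sigma g w rho : nat)
    (H : 'M[R]_L) (tau : 'I_L -> option 'I_P) :
  admissible_transform H -> (0 < P)%N -> (0 < sigma)%N -> (0 < g)%N ->
  (0 < w)%N -> (sigma * g <= n./2)%N -> (rho <= n)%N ->
  (forall delta : R, 0 < delta <= 1 / 2 -> cluster_code m n s rho delta) ->
  (forall p, #|[set l | tau l == Some p]%SET| = w) ->
  (forall l l' : 'I_L, l' = l.+1 :> nat ->
     tau l = tau l' \/ (sigma <= n0)%N /\ (tau l = None \/ tau l' = None)) ->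
  attainable m n n0 s H ((P * sigma)%:R * ln (g * rho.-1).+1%:R / 2 ^+ 15 : R).
Proof.
move=> Hadm P0 sigma0 g0 w0 sgn rn code tauF tauS.
have n0' : (0 < n)%N by have := sgn; nia.
(* This first code only serves to learn [2 <= rho], so that [q > 1] before [delta] is chosen. *)
have [K [_ [_ [_ [_ [[K0 Krho] _]]]]]] : cluster_code m n s rho (1 / 2 : R).
  by apply: code; apply/andP; split; lra.
set q := (g * rho.-1).+1.
have q1 : (1 < q)%N by rewrite /q ltnS muln_gt0 g0; lia.
pose x : R := ln q%:R.
have x0 : 0 < x by rewrite ln_gt0 // ltr1n.
have N0 : 0 < n%:R * w%:R :> R by rewrite mulr_gt0 ?ltr0n.
(* The largest value that the budget [chi] allows; it leads to the constant 8 x 64 x 64 = 2^15. It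
   is at most 1/2 because [q <= (n + 1)^2]. *)
pose delta : R := Num.sqrt (x / (64 * (n%:R * w%:R))).
have delta2 : delta ^+ 2 = x / (64 * (n%:R * w%:R)).
  by rewrite sqr_sqrtr // divr_ge0 ?(ltW x0) // mulr_ge0 // ltW.
have delta0 : 0 < delta by rewrite sqrtr_gt0 divr_gt0 // mulr_gt0.
have x_le : x <= 2 * n%:R.
  have gn : (g <= n)%N by have := odd_double_half n; case: odd; nia.
  have qn : (q <= n.+1 ^ 2)%N.
    rewrite /q expnS expn1; have : (rho.-1 <= n)%N by lia.
    by move: (rho.-1) => z zn; nia.
  apply: (@le_trans _ _ (ln (n.+1%:R ^+ 2))).
    by rewrite ler_ln ?posrE ?exprn_gt0 ?ltr0n // -natrX ler_nat.
  rewrite lnXn ?ltr0n // -[leLHS]mulr_natl ler_pM2l //.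
  by apply: le_trans (ln_le_subr1 _) _; rewrite ?ltr0n // -natr1 addrK.
have delta_half : delta <= 1 / 2.
  rewrite -(@ler_pXn2r _ 2) ?nnegrE ?(ltW delta0) // delta2.
  rewrite ler_pdivrMr; last by rewrite mulr_gt0.
  have : n%:R <= n%:R * w%:R :> R by rewrite ler_peMr // ler1n.
  by rewrite expr2; lra.
have dd : 0 < delta <= 1 / 2 by rewrite delta0 delta_half.
have [K' [gg [emb [bcls [beta [[K0' Krho'] [g1 [g2 [g3 [g4 [g5 [g6 g7]]]]]]]]]]]] :=
  code _ dd.
have qE : q = (g * #|K'|).+1 by rewrite /q -Krho'.
apply: attainable_le (attainable_cluster Hadm P0 sigma0 g0 w0 K0' sgn
  delta0 g1 g2 g3 g4 g5 g6 g7 tauF tauS _).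
  rewrite delta2 -/x le_eqVlt; apply/orP; left; apply/eqP.
  by field; apply/andP; split; rewrite gt_eqF ?ltr0n.
by rewrite delta2 -qE -/x le_eqVlt; apply/orP; left; apply/eqP; field;
  apply/andP; split; rewrite gt_eqF ?ltr0n.
Qed.

(** Take the largest [r] whose Walsh code fits. The next one violates the number of classes or the
    sparsity; either way [2^r] is at least [sqrt gamma * m / 4], in the second case through
    [gamma m^2 <= s]. *)
Lemma exists_cluster_code (R : realType) (m n s : nat) (gamma : R) :
  (2 <= m)%N -> (2 <= s)%N -> (m, s) <> (2%N, 2%N) -> (2 * m <= n)%N ->
  0 < gamma <= 1 / 2 -> gamma * m%:R ^+ 2 <= s%:R ->
  exists rho, [/\ (2 <= rho <= m)%N, gamma * m%:R ^+ 2 <= 16 * rho%:R ^+ 2 &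
    forall delta : R, 0 < delta <= 1 / 2 -> cluster_code m n s rho delta].
Proof.
move=> m2 s2 ms mn /andP[gamma0 gamma1] gms.
have [m_eq|m_neq] := eqVneq m 2%N.
  subst m; exists 2%N; split => //; first by rewrite !expr2; lra.
  move=> delta dd; apply: cluster_code_two => //.
  by case: (s =P 2%N) => [e|]; [rewrite e in ms|lia].
pose ok r := (2 ^ r.+1 <= m.+1)%N && (2 ^ r * (2 ^ r).-1 <= s)%N.
have ok1 : ok 1%N by rewrite /ok; apply/andP; split; lia.
have okm r : ok r -> (r <= m)%N.
  by move=> /andP[h _]; have := ltn_expl r.+1 (isT : 1 < 2)%N; lia.
case: (ex_maxnP (ex_intro _ 1%N ok1) okm) => r /andP[rm rs] rmax.
have r0 : (0 < r)%N by apply: rmax.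
have r2 : (1 < 2 ^ r)%N by rewrite -{1}(expn0 2) ltn_exp2l.
exists (2 ^ r)%N; split; last by move=> delta dd; apply: cluster_code_walsh.
  by rewrite r2 /=; move: rm; rewrite expnS; lia.
have m0 : 0 <= m%:R ^+ 2 :> R by rewrite exprn_ge0.
have : ~~ ok r.+1 by apply/negP => /rmax; rewrite ltnn.
rewrite negb_and -!ltnNge => /orP[h|h].
  have : (m ^ 2 <= 16 * (2 ^ r) ^ 2)%N.
    by move: h; rewrite !expnS; move: (2 ^ r)%N => z; rewrite !expn0; nia.
  rewrite -(ler_nat R) natrM !natrX => h2.
  apply: le_trans h2; rewrite -[leRHS]mul1r ler_wpM2r //; lra.
apply: (le_trans gms).
have : (s <= 16 * (2 ^ r) ^ 2)%N.
  move: h r2; rewrite !expnS; move: (2 ^ r)%N => z; rewrite !expn0; nia.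
by rewrite -(ler_nat R) natrM !natrX.
Qed.

(** After taking logarithms, the additive terms [4 ln 2] and [|ln gamma|] are absorbed by multiples
    of [ln rho], since [ln rho >= ln 2 >= 1/2]. *)
Lemma ln_classes_le (R : realType) (m rho : nat) (gamma : R) :
  (1 <= m)%N -> (2 <= rho)%N -> 0 < gamma ->
  gamma * m%:R ^+ 2 <= 16 * rho%:R ^+ 2 ->
  ln m%:R <= 3 * (1 + `|ln gamma|) * ln rho%:R.
Proof.
move=> m1 rho2 gamma0 h.
have m0 : 0 < m%:R :> R by rewrite ltr0n.
have r0 : 0 < rho%:R :> R by rewrite ltr0n; lia.
have : ln (gamma * m%:R ^+ 2) <= ln (2 ^+ 4 * rho%:R ^+ 2).
  rewrite ler_ln ?posrE ?mulr_gt0 ?exprn_gt0 //.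
  by rewrite (_ : 2 ^+ 4 = 16) //; ring.
rewrite [ln (gamma * _)]lnM ?posrE ?exprn_gt0 //.
rewrite [ln (2 ^+ 4 * _)]lnM ?posrE ?exprn_gt0 // !lnXn //.
rewrite -(mulr_natl (ln m%:R) 2) -(mulr_natl (ln 2) 4) -(mulr_natl (ln rho%:R) 2).
have h2 := ln2_ge_half R.
have hr : ln 2 <= ln rho%:R :> R by rewrite ler_ln ?posrE // ler_nat.
have hg : - ln gamma <= `|ln gamma| by rewrite -normrN ler_norm.
have hg0 := normr_ge0 (ln gamma).
move: (ln m%:R) (ln rho%:R) (ln gamma) `|ln gamma| (ln 2) h2 hr hg hg0 => M r G D t.
by move=> h2 hr hg hg0 hh; nra.
Qed.

(** One row is shared by all [L] times and slots consist of one node, so each node of the first half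
    chooses its class once. The 9 is a 3 from rounding [n / 2] and a 3 from [ln_classes_le]. *)
Lemma attainable_static_clusters (R : realType) (m n n0 L s : nat)
    (H : 'M[R]_L) (gamma : R) :
  admissible_transform H ->
  (2 <= m)%N -> (2 <= s)%N -> (m, s) <> (2%N, 2%N) -> (2 * m <= n)%N ->
  0 < gamma <= 1 / 2 -> gamma * m%:R ^+ 2 <= s%:R -> (2 <= L)%N ->
  attainable m n n0 s H
    (n%:R * ln m%:R / (9 * 2 ^+ 15 * (1 + `|ln gamma|))).
Proof.
move=> Hadm m2 s2 ms mn gg gms L2.
have [rho [/andP[rho2 rhom] hrho code]] := exists_cluster_code m2 s2 ms mn gg gms.
have gamma0 : 0 < gamma by case/andP: gg.
have lnm := @ln_classes_le R m rho gamma (ltnW m2) rho2 gamma0 hrho.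
have n2 : (0 < n./2)%N by have := odd_double_half n; case: odd; lia.
have L0 : (0 < L)%N by lia.
have h := @attainable_code R m n n0 L s 1 n./2 1 L rho H (fun=> Some ord0)
  Hadm isT n2 isT L0 _ _ code _ _.
apply: attainable_le (h _ _ _ _).
- rewrite !mul1n prednK; last lia.
  have D0 : 0 < 1 + `|ln gamma| by have := normr_ge0 (ln gamma); lra.
  have n3 : n%:R <= 3 * (n./2)%:R :> R.
    by rewrite -natrM ler_nat; have := odd_double_half n; case: odd; lia.
  rewrite ler_pdivrMr ?mulr_gt0 ?exprn_gt0 //.
  have lnm0 : 0 <= ln m%:R :> R by rewrite ln_ge0 // ler1n; lia.
  have h1 := ler_pM (ler0n R n) lnm0 n3 lnm.
  apply: (le_trans h1); rewrite le_eqVlt; apply/orP; left; apply/eqP.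
  by field.
- by rewrite muln1.
- by lia.
- move=> p; rewrite (_ : [set l | _]%SET = finset.setT) ?cardsT ?card_ord //.
  apply/setP => l; by rewrite !inE (ord1 p) eqxx.
- by move=> l l' _; left.
Qed.

(** Time [2 p + 1] gets row [p]. A rest separates any two times with moves, so the rows can be
    chosen independently. *)
Definition odd_time (L : nat) (l : 'I_L) : option 'I_(L./2) :=
  if odd l then insub l./2 else None.

Lemma odd_time_fiber (L : nat) (p : 'I_(L./2)) :
  #|[set l | @odd_time L l == Some p]%SET| = 1%N.
Proof.
have pL : (p.*2.+1 < L)%N.
  by have := ltn_ord p; have := odd_double_half L; case: (odd L); lia.
rewrite (_ : [set l | _]%SET = [set Ordinal pL]%SET) ?cards1 //.
apply/setP => l; rewrite !inE /odd_time; apply/eqP/eqP => [|->].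
  case: ifP => // ol; case: insubP => // q _ e [qp].
  by apply: val_inj; rewrite /= -qp e; have := odd_double_half l; rewrite ol; lia.
have e1 : odd (Ordinal pL) by rewrite /= odd_double.
have e2 : (Ordinal pL)./2 = p by rewrite /= uphalf_double.
by rewrite e1 e2 valK.
Qed.

(** The choice of a node in its slot supplies [ln (n / n0)] up to constants, the choice of its class
    [ln m]. With [D = 1 + |ln gamma|], the parts [ln m], 1 and [ln (n / n0)] are at most [3 D], 2
    and 3 times [ln q]; rounding [L / 2] turns the resulting 8 into 24. *)
Lemma attainable_moving_clusters (R : realType) (m n n0 L s : nat)
    (H : 'M[R]_L) (gamma : R) :
  admissible_transform H ->
  (2 <= m)%N -> (2 <= s)%N -> (m, s) <> (2%N, 2%N) -> (2 * m <= n)%N ->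
  0 < gamma <= 1 / 2 -> gamma * m%:R ^+ 2 <= s%:R -> (2 <= L)%N ->
  (0 < n0)%N -> (2 * n0 <= n)%N ->
  attainable m n n0 s H
    (L%:R * (n0%:R * ln (m%:R * n%:R * expR 1 / n0%:R))
     / (24 * 2 ^+ 15 * (1 + `|ln gamma|))).
Proof.
move=> Hadm m2 s2 ms mn gg gms L2 n00 n0n.
have [rho [/andP[rho2 rhom] hrho code]] := exists_cluster_code m2 s2 ms mn gg gms.
have gamma0 : 0 < gamma by case/andP: gg.
have rhon : (rho <= n)%N by clear -rhom mn; lia.
have [n_gt0 m_gt0 rho_gt0] : [/\ 0 < n, 0 < m & 0 < rho]%N.
  by clear -m2 mn rho2; split; lia.
have n3 : (n <= 3 * n./2)%N.
  by clear -m2 mn; have := odd_double_half n; case: odd; lia.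
have L3 : (L <= 3 * L./2)%N.
  by clear -L2; have := odd_double_half L; case: odd; lia.
have n0v : (n0 <= n./2)%N.
  by clear -n0n; have := odd_double_half n; case: odd; lia.
set g := (n./2 %/ n0)%N.
have g0 : (0 < g)%N by rewrite divn_gt0.
have P0 : (0 < L./2)%N by clear -L2 L3; lia.
set q := (g * rho.-1).+1.
have q_rho : (rho <= q)%N.
  by rewrite /q; clear -g0 rho2; case: g g0 => // k _; nia.
have q_g : (g.+1 <= q)%N by rewrite /q ltnS leq_pmulr //; clear -rho2; lia.
have nq_nat : (n <= 4 * q * n0)%N.
  have := ltn_ceil n./2 n00; rewrite -/g => h1.
  by clear -h1 n3 q_g; nia.
have lnm := @ln_classes_le R m rho gamma m_gt0 rho2 gamma0 hrho.
have h := @attainable_code R m n n0 L s L./2 n0 g 1 rho H (@odd_time L)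
  Hadm P0 n00 g0 isT _ _ code (@odd_time_fiber L) _.
apply: attainable_le (h _ _ _).
- have D1 : 1 <= 1 + `|ln gamma| by have := normr_ge0 (ln gamma); lra.
  have D0 : 0 < 1 + `|ln gamma| by lra.
  move: (1 + `|ln gamma|) D1 D0 lnm => D D1 D0 lnm.
  have q0 : 0 < q%:R :> R by rewrite ltr0n.
  have lnq_rho : ln rho%:R <= ln q%:R :> R.
    by rewrite ler_ln ?posrE ?ltr0n ?ler_nat.
  have n0R : 0 < n0%:R :> R by rewrite ltr0n.
  have nR : 0 < n%:R :> R by rewrite ltr0n.
  have mR : 0 < m%:R :> R by rewrite ltr0n.
  have nq : n%:R / n0%:R <= 4 * q%:R :> R.
    by rewrite ler_pdivrMr // -!natrM ler_nat.
  have ln4 : ln (4 * q%:R) = 2 * ln 2 + ln q%:R :> R.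
    rewrite lnM ?posrE // (_ : 4 = 2 ^+ 2) ?lnXn //; last by ring.
    by rewrite -(mulr_natl (ln 2) 2).
  have h2 := ln2_ge_half R.
  have hr : ln 2 <= ln rho%:R :> R by rewrite ler_ln ?posrE ?ltr0n ?ler_nat.
  have lnE : ln (m%:R * n%:R * expR 1 / n0%:R) =
      ln m%:R + 1 + ln (n%:R / n0%:R) :> R.
    rewrite !ln_div ?posrE ?mulr_gt0 ?expR_gt0 // !lnM ?posrE ?mulr_gt0 ?expR_gt0 //.
    by rewrite expRK; ring.
  have lnn : ln (n%:R / n0%:R) <= 2 * ln 2 + ln q%:R :> R.
    by rewrite -ln4 ler_ln ?posrE ?divr_gt0 ?mulr_gt0.
  have total : ln (m%:R * n%:R * expR 1 / n0%:R) <= 8 * D * ln q%:R :> R.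
    rewrite lnE.
    have h3 : 3 * D * ln rho%:R <= 3 * D * ln q%:R.
      by rewrite ler_wpM2l // mulr_ge0 // ltW.
    have h4 : ln q%:R <= D * ln q%:R by rewrite ler_peMl //; lra.
    lra.
  have L3R : L%:R <= 3 * (L./2)%:R :> R by rewrite -natrM ler_nat.
  have q1 : 0 <= ln q%:R :> R by lra.
  have B0 : 0 <= n0%:R * (8 * D * ln q%:R) :> R.
    by rewrite !mulr_ge0 // ltW.
  rewrite ler_pdivrMr; last by rewrite !mulr_gt0 // exprn_gt0.
  apply: (le_trans (ler_wpM2l (ler0n R L) (ler_wpM2l (ltW n0R) total))).
  apply: (le_trans (ler_wpM2r B0 L3R)).
  rewrite natrM le_eqVlt; apply/orP; left; apply/eqP.
  by field.
- by rewrite mulnC leq_trunc_div.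
- exact: rhon.
- move=> l l' ll'; right; split => //.
  by rewrite /odd_time ll' /=; case: (odd l); [right|left].
Qed.

(** * Sparsity term of the rate *)

Ltac drop_reals := repeat match goal with
  | h : is_true (Order.le _ _) |- _ => clear h
  | h : is_true (Order.lt _ _) |- _ => clear h
  end.

Lemma ln_floor (R : realType) (L t : nat) :
  (0 < t)%N -> (2 * t <= L)%N -> ln (L%:R / t%:R) <= 2 * ln (L %/ t)%:R :> R.
Proof.
move=> t0 tL.
have g2 : (1 < L %/ t)%N by rewrite leq_divRL.
have tR : 0 < t%:R :> R by rewrite ltr0n.
rewrite [leRHS]mulr_natl -lnXn ?ltr0n; last by lia.
rewrite ler_ln ?posrE ?exprn_gt0 ?divr_gt0 ?ltr0n //; try lia.
rewrite ler_pdivrMr // -natrX -natrM ler_nat.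
have := ltn_ceil L t0; move: (L %/ t)%N g2 => g g2 h.
by rewrite expnS expn1; nia.
Qed.

Lemma attainable_sparse_ln (R : realType) (m n n0 L s b t : nat)
    (H : 'M[R]_L) :
  admissible_transform H -> (0 < m)%N -> (2 * m <= n)%N ->
  (0 < b <= nblocks m)%N -> (0 < t)%N -> (2 * t <= L)%N -> (b * t.+1 <= s)%N ->
  t%:R ^+ 2 * ln (L%:R / t%:R) <= 68 * L%:R * (n %/ m).+1%:R ^+ 2 :> R ->
  attainable m n n0 s H ((b * t)%:R * ln (L%:R / t%:R) / 2 ^+ 18).
Proof.
move=> Hadm m0 mn bM t0 tL bts ht.
have tR : 0 < t%:R :> R by rewrite ltr0n.
have LR : 0 < L%:R :> R by rewrite ltr0n; lia.
pose x : R := ln (L%:R / t%:R).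
have x0 : 0 < x.
  by rewrite ln_gt0 // ltr_pdivlMr // mul1r ltr_nat; lia.
set nu := (n %/ m)%N in ht *.
have nu2 : (1 < nu)%N by rewrite leq_divRL.
have N0 : 0 < nu.+1%:R :> R by rewrite ltr0n.
(* The 2^9 is set by the amplitude: [(2 delta t)^2 <= L] becomes [t^2 x <= 2^7 L (nu + 1)^2], and 68
   < 2^7. The chi-square budget then holds with room, by [ln_floor]. *)
pose delta : R := Num.sqrt (x / (2 ^+ 9 * nu.+1%:R ^+ 2)).
have D0 : 0 < 2 ^+ 9 * nu.+1%:R ^+ 2 :> R by rewrite !mulr_gt0 ?exprn_gt0.
have delta2 : delta ^+ 2 = x / (2 ^+ 9 * nu.+1%:R ^+ 2).
  by rewrite sqr_sqrtr // divr_ge0 ?(ltW x0) ?(ltW D0).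
have delta0 : 0 < delta by rewrite sqrtr_gt0 divr_gt0.
apply: attainable_le (attainable_sparse n0 Hadm m0 mn bM t0 tL bts delta0 _ _).
- rewrite delta2 -/x -/nu natrM.
  have nu3 : nu%:R = nu.+1%:R - 1 :> R by rewrite -natr1 addrK.
  have nu4 : nu.-1%:R = nu.+1%:R - 2 :> R.
    by apply/eqP; rewrite eq_sym subr_eq -natrD eqr_nat; clear -nu2; lia.
  rewrite natrM nu3 nu4.
  have nuR : 3 <= nu.+1%:R :> R by rewrite ler_nat.
  set z := nu.+1%:R in nuR N0 D0 *.
  have z2 : 2 / 9 * z ^+ 2 <= (z - 1) * (z - 2) by rewrite expr2; nra.
  have y0 : 0 <= b%:R * t%:R * x :> R by rewrite !mulr_ge0 // ltW.
  have -> : (z - 1) * (z - 2) * (x / (2 ^+ 9 * z ^+ 2)) * (b%:R * t%:R) / 64 =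
     b%:R * t%:R * x * ((z - 1) * (z - 2) / (2 ^+ 15 * z ^+ 2)).
    by field; rewrite gt_eqF.
  apply: ler_wpM2l => //.
  rewrite ler_pdivlMr; last by rewrite mulr_gt0 ?exprn_gt0.
  have : 0 <= z ^+ 2 by apply: sqr_ge0.
  by move: z2; move: ((z - 1) * (z - 2)) (z ^+ 2) => u v; lra.
- have h0 : 0 <= 2 * delta * t%:R by rewrite !mulr_ge0 // ltW.
  rewrite -(@ler_pXn2r _ 2) ?nnegrE ?sqrtr_ge0 // sqr_sqrtr ?(ltW LR) //.
  rewrite !exprMn delta2.
  have -> : 2 ^+ 2 * (x / (2 ^+ 9 * nu.+1%:R ^+ 2)) * t%:R ^+ 2 =
    (t%:R ^+ 2 * x) / (2 ^+ 7 * nu.+1%:R ^+ 2) by field; rewrite gt_eqF.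
  rewrite ler_pdivrMr; last by rewrite mulr_gt0 ?exprn_gt0.
  have : 0 <= L%:R * nu.+1%:R ^+ 2 :> R by rewrite mulr_ge0 ?sqr_ge0 // ltW.
  by move: ht; rewrite -/x; lra.
- rewrite exprMn delta2.
  have -> : 64 * (nu.+1%:R ^+ 2 * (x / (2 ^+ 9 * nu.+1%:R ^+ 2))) = x / 8.
    by field; rewrite gt_eqF.
  by have := ln_floor R t0 tL; rewrite -/x; lra.
Qed.

Lemma attainable_sparse_rate (R : realType) (m n n0 L s : nat)
    (H : 'M[R]_L) (gamma : R) :
  admissible_transform H ->
  (0 < m)%N -> (2 <= s)%N -> (2 * m <= n)%N ->
  0 < gamma -> gamma * m%:R ^+ 2 <= s%:R -> (2 <= L)%N ->
  s%:R ^+ 2 * ln (2 * L%:R * (nblocks m)%:R / s%:R)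
    <= 68 * L%:R * (nblocks m)%:R * n%:R ^+ 2 :> R ->
  exists r, [/\ 0 <= r,
    s%:R * ln (L%:R * m%:R ^+ 2 / s%:R) <= 2 ^+ 9 * (1 + `|ln gamma|) * r &
    attainable m n n0 s H (r / 2 ^+ 18)].
Proof.
move=> Hadm m0 s2 mn gamma0 gms L2.
have : 272 <= 2 ^+ 9 :> R by lra.
move: (2 ^+ 9) => K K_ge.
set M := nblocks m; move=> hs.
have M2 : (m ^ 2 <= 2 * M)%N.
  rewrite /M card_block expnS expn1.
  have := odd_double_half (m * m.+1); rewrite oddM /=.
  by case: (odd m) => /=; drop_reals; nia.
have M0 : (0 < M)%N.
  by move: M2; rewrite expnS expn1; case: (M) => //; drop_reals; nia.
have sR : 0 < s%:R :> R by rewrite ltr0n; drop_reals; lia.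
have MR : 0 < M%:R :> R by rewrite ltr0n.
have mR : 0 < m%:R :> R by rewrite ltr0n.
have LR : 0 < L%:R :> R by rewrite ltr0n; drop_reals; lia.
have nR : 0 < n%:R :> R by rewrite ltr0n; drop_reals; lia.
have D1 : 1 <= 1 + `|ln gamma| by have := normr_ge0 (ln gamma); lra.
have KD : 272 <= K * (1 + `|ln gamma|) by nra.
have M2R : m%:R ^+ 2 <= 2 * M%:R :> R by rewrite -natrX -natrM ler_nat.
set nu := (n %/ m)%N.
have nuR : n%:R <= m%:R * nu.+1%:R :> R.
  by rewrite -natrM ler_nat mulnC ltnW // ltn_ceil.
have nu1 : 1 <= nu.+1%:R ^+ 2 :> R by rewrite -natrX ler1n expn_gt0.
have h2 := ln2_ge_half R.
set T := s%:R * _.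
have T_le : ln (L%:R * m%:R ^+ 2 / s%:R) <= ln (2 * L%:R * M%:R / s%:R) :> R.
  rewrite ler_ln ?posrE ?divr_gt0 ?mulr_gt0 ?exprn_gt0 //.
  rewrite ler_pM2r ?invr_gt0 //; have := ler_wpM2l (ltW LR) M2R; lra.
have [s4|s4] := leqP s (4 * M).
(* One spike per block besides the coefficient that lifts it, so [b] is about [s / 2], capped by
   [M]. Here [gamma m^2 <= s] bounds [L m^2 / s] by [L / gamma], another source of [|ln gamma|]. *)
- pose b := minn s./2 M.
  have b0 : (0 < b)%N.
    rewrite leq_min M0 andbT; have := odd_double_half s.
    by case: odd; drop_reals; lia.
  have bs : (2 * b <= s)%N.
    have : (b <= s./2)%N by apply: geq_minl.
    by have := odd_double_half s; case: odd; drop_reals; lia.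
  have sb : (s <= 4 * b)%N.
    rewrite /b; have := odd_double_half s.
    by case: (leqP s./2 M) => _; case: odd; drop_reals; lia.
  have bM : (0 < b <= M)%N by rewrite b0 geq_minr.
  have lnL : ln 2 <= ln L%:R :> R by rewrite ler_ln ?posrE // ler_nat.
  have := @attainable_sparse_ln R m n n0 L s b 1 H Hadm m0 mn bM isT _ _ _.
  rewrite !muln1 divr1 expr1n mul1r => hatt.
  exists (b%:R * ln L%:R); split.
  + by rewrite mulr_ge0 //; lra.
  + have lnT : ln (L%:R * m%:R ^+ 2 / s%:R) <= ln L%:R + `|ln gamma|.
      apply: le_trans (_ : ln (L%:R / gamma) <= _).
        rewrite ler_ln ?posrE ?divr_gt0 ?mulr_gt0 ?exprn_gt0 //.
        rewrite ler_pdivrMr // mulrAC ler_pdivlMr //.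
        by have := ler_wpM2l (ltW LR) gms; lra.
      rewrite ln_div ?posrE // lerD2l -normrN; exact: ler_norm.
    have g0 := normr_ge0 (ln gamma).
    have lnT2 : ln (L%:R * m%:R ^+ 2 / s%:R) <= 2 * (1 + `|ln gamma|) * ln L%:R.
      by nra.
    have sbR : s%:R <= 4 * b%:R :> R by rewrite -natrM ler_nat.
    have P0 : 0 <= 2 * (1 + `|ln gamma|) * ln L%:R by nra.
    apply: (le_trans (ler_wpM2l (ltW sR) lnT2)).
    apply: (le_trans (ler_wpM2r P0 sbR)).
    have : 0 <= b%:R * ((1 + `|ln gamma|) * ln L%:R) :> R by rewrite mulr_ge0 //; nra.
    move: K_ge; move: (1 + _) => D.
    have -> : 4 * b%:R * (2 * D * ln L%:R) = 8 * (b%:R * (D * ln L%:R)) by ring.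
    have -> : K * D * (b%:R * ln L%:R) = K * (b%:R * (D * ln L%:R)) by ring.
    by move=> K_ge c0; nra.
  + apply: hatt => //; first by rewrite muln2 -mul2n.
    rewrite -/nu; have : ln L%:R <= L%:R :> R by apply/ltW/ln_sublinear.
    by nra.
have [sL|sL] := leqP s (L * M).
(* As [t >= 2], [M (t + 1) <= 2 M t <= s] pays for the lifts of all blocks. The amplitude condition
   is [hs] rescaled: [ln (L / t) <= 2 e], and [n^2 <= 2 M (nu + 1)^2]. *)
- pose t := (s %/ (2 * M))%N.
  have M20 : (0 < 2 * M)%N by drop_reals; lia.
  have t2 : (2 <= t)%N by rewrite leq_divRL //; drop_reals; lia.
  have tM : (2 * M * t <= s)%N by rewrite mulnC leq_trunc_div.
  have tM3 : (s <= 3 * (M * t))%N.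
    have := ltn_ceil s M20; rewrite -/t => h; drop_reals; nia.
  have tL : (2 * t <= L)%N.
    by rewrite -(leq_pmul2l M0); drop_reals; lia.
  have tR : 0 < t%:R :> R by rewrite ltr0n; drop_reals; lia.
  have tMR : 2 * M%:R * t%:R <= s%:R :> R by rewrite -!natrM ler_nat.
  have tM3R : s%:R <= 3 * (M%:R * t%:R) :> R by rewrite -!natrM ler_nat.
  have sLR : s%:R <= L%:R * M%:R :> R by rewrite -!natrM ler_nat.
  set e := ln (2 * L%:R * M%:R / s%:R) in hs T_le.
  have lnt : e <= ln (L%:R / t%:R).
    rewrite ler_ln ?posrE ?divr_gt0 ?mulr_gt0 //.
    rewrite ler_pdivrMr // [leRHS]mulrAC ler_pdivlMr //.
    by have := ler_wpM2l (ltW LR) tMR; lra.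
  have lnt2 : ln (L%:R / t%:R) <= 2 * e.
    rewrite /e [leRHS]mulr_natl -lnXn ?divr_gt0 ?mulr_gt0 //.
    rewrite ler_ln ?posrE ?exprn_gt0 ?divr_gt0 ?mulr_gt0 //.
    apply: (@le_trans _ _ (3 * (L%:R * M%:R / s%:R))).
      rewrite ler_pdivrMr // [leRHS]mulrAC [leRHS]mulrA ler_pdivlMr //.
      by have := ler_wpM2l (ltW LR) tM3R; lra.
    have : 1 <= L%:R * M%:R / s%:R :> R by rewrite ler_pdivlMr // mul1r.
    rewrite -!mulrA exprMn; move: (L%:R * _) => y y1.
    by rewrite expr2; nra.
  have e0 : 0 <= e by lra.
  exists ((M * t)%:R * ln (L%:R / t%:R)); split.
  + by rewrite mulr_ge0 //; lra.
  + have A0 : 0 <= M%:R * t%:R * ln (L%:R / t%:R) :> R.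
      by apply: mulr_ge0; [exact: mulr_ge0|lra].
    apply: (@le_trans _ _ (3 * (M%:R * t%:R * ln (L%:R / t%:R)))).
      apply: (le_trans (ler_wpM2l (ltW sR) (le_trans T_le lnt))).
      rewrite [leRHS]mulrA; apply: ler_wpM2r => //; lra.
    by rewrite natrM; apply: ler_wpM2r => //; lra.
  + apply: attainable_sparse_ln => //; first by rewrite M0 leqnn.
    * by drop_reals; lia.
    * by drop_reals; nia.
    * rewrite -/nu.
      apply: (@le_trans _ _ ((s%:R / (2 * M%:R)) ^+ 2 * (2 * e))).
        apply: ler_pM => //; first by lra.
        have tle : t%:R <= s%:R / (2 * M%:R) :> R.
          by rewrite ler_pdivlMr ?mulr_gt0 //; lra.
        rewrite ler_pXn2r ?nnegrE //; exact: le_trans tle.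
      have -> : (s%:R / (2 * M%:R)) ^+ 2 * (2 * e) =
         (s%:R ^+ 2 * e) / (2 * M%:R ^+ 2) by field; rewrite gt_eqF.
      rewrite ler_pdivrMr ?mulr_gt0 ?exprn_gt0 //.
      apply: (le_trans hs).
      have n2 : n%:R ^+ 2 <= 2 * M%:R * nu.+1%:R ^+ 2 :> R.
        apply: (@le_trans _ _ ((m%:R * nu.+1%:R) ^+ 2)).
          by rewrite ler_pXn2r ?nnegrE ?mulr_ge0 // ltW.
        by rewrite exprMn ler_wpM2r // sqr_ge0.
      have c0 : 0 <= 68 * L%:R * M%:R :> R by rewrite !mulr_ge0 // ltW.
      by have := ler_wpM2l c0 n2; rewrite [M%:R ^+ 2]expr2; lra.
(* The budget now exceeds the number of coefficients; [t] is limited by the number of times and by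
   the amplitude, for which [t <= (nu + 1)^2] suffices because [t ln (L / t) <= L]. *)
- pose t := minn L./2 (nu.+1 ^ 2).
  have L1 : (0 < L./2)%N by have := odd_double_half L; case: odd; drop_reals; lia.
  have t0 : (0 < t)%N by rewrite leq_min L1 expn_gt0.
  have tL : (2 * t <= L)%N.
    have : (t <= L./2)%N by apply: geq_minl.
    by have := odd_double_half L; case: odd; drop_reals; lia.
  have tR : 0 < t%:R :> R by rewrite ltr0n.
  have sLR : L%:R * M%:R <= s%:R :> R by rewrite -!natrM ler_nat ltnW.
  have lnt : ln 2 <= ln (L%:R / t%:R) :> R.
    rewrite ler_ln ?posrE ?divr_gt0 // ler_pdivlMr // -natrM ler_nat //.
  exists ((M * t)%:R * ln (L%:R / t%:R)); split.
  + by rewrite mulr_ge0 //; lra.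
  + have MtR : 0 <= (M * t)%:R :> R by [].
    have bits : (M * t)%:R <= 2 * ((M * t)%:R * ln (L%:R / t%:R)) :> R by nra.
    set r := _ * ln (_ / t%:R) in bits *.
    have r0 : 0 <= r by lra.
    apply: (@le_trans _ _ (272 * r)); last exact: ler_wpM2r.
    have [T0|T0] := leP T 0; first by lra.
    set e := ln (2 * L%:R * M%:R / s%:R) in hs T_le.
    have eps0 : 0 < ln (L%:R * m%:R ^+ 2 / s%:R) :> R.
      by move: T0; rewrite /T pmulr_rgt0.
    (* If time is the limit, a positive logarithm forces [s <= 2 L M] and is then at most 1. If the
       amplitude is, [hs] and [L M <= s] give [T <= 68 n^2 <= 136 M t], and [ln (L / t) >= 1/2]
       doubles 136 to 272. *)
    have [tE|tE] := leqP L./2 (nu.+1 ^ 2).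
      have tE' : t = L./2 by apply/minn_idPl.
      have L3 : L%:R <= 3 * t%:R :> R.
        rewrite tE' -natrM ler_nat; have := odd_double_half L.
        by case: odd; drop_reals; lia.
      have s_le : s%:R <= 2 * (L%:R * M%:R) :> R.
        apply: (@le_trans _ _ (L%:R * m%:R ^+ 2)); last first.
          by have := ler_wpM2l (ltW LR) M2R; lra.
        move: eps0; rewrite leNgt; apply: contraL => h; rewrite -leNgt ln_le0 //.
        by rewrite ler_pdivrMr // mul1r ltW.
      have eps1 : ln (L%:R * m%:R ^+ 2 / s%:R) <= 1 :> R.
        apply: le_trans (ln_le_subr1 _) _; first by rewrite divr_gt0 ?mulr_gt0 ?exprn_gt0.
        suff : L%:R * m%:R ^+ 2 / s%:R <= 2 :> R by lra.
        rewrite ler_pdivrMr //; have := ler_wpM2l (ltW LR) M2R; lra.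
      apply: (@le_trans _ _ (2 * (L%:R * M%:R))).
        rewrite -[leRHS]mulr1 /T; apply: ler_pM => //; exact: ltW.
      apply: (@le_trans _ _ (6 * (M * t)%:R)); last by lra.
      by rewrite natrM; have := ler_wpM2l (ltW MR) L3; lra.
    have tE' : t = (nu.+1 ^ 2)%N by apply/minn_idPr/ltnW.
    have Mt : n%:R ^+ 2 <= 2 * (M * t)%:R :> R.
      apply: (@le_trans _ _ ((m%:R * nu.+1%:R) ^+ 2)).
        by rewrite ler_pXn2r ?nnegrE ?mulr_ge0 // ltW.
      rewrite exprMn natrM tE' natrX mulrA ler_wpM2r //; lra.
    have sT : s%:R * T <= s%:R * (68 * n%:R ^+ 2).
      rewrite /T mulrA -expr2.
      apply: (le_trans (ler_wpM2l (sqr_ge0 _) T_le)); apply: (le_trans hs).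
      have : 0 <= 68 * n%:R ^+ 2 :> R by rewrite mulr_ge0 ?sqr_ge0.
      by move=> c0; have := ler_wpM2r c0 sLR; lra.
    by rewrite ler_pM2l // in sT; lra.
  + apply: attainable_sparse_ln => //; first by rewrite M0 leqnn.
    * apply: leq_trans (ltnW sL); rewrite mulnC leq_mul2r; drop_reals; lia.
    * rewrite -/nu.
      have h1 : t%:R * ln (L%:R / t%:R) <= L%:R :> R.
        rewrite -ler_pdivlMl // [leRHS]mulrC; apply/ltW/ln_sublinear.
        exact: divr_gt0.
      have h3 : t%:R <= nu.+1%:R ^+ 2 :> R by rewrite -natrX ler_nat geq_minr.
      rewrite expr2 -mulrA.
      apply: (le_trans (ler_wpM2l (ltW tR) h1)).
      apply: (le_trans (ler_wpM2r (ltW LR) h3)).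
      have : 0 <= nu.+1%:R ^+ 2 * L%:R :> R by rewrite mulr_ge0 ?sqr_ge0 // ltW.
      lra.
Qed.

(** * Combination of the three terms *)

Lemma attainable_rate (R : realType) (m n L n0 s : nat) (H : 'M[R]_L)
    (gamma : R) :
  0 < gamma <= 1 / 2 -> (1 <= m)%N -> (m = 1%N -> n0 = 0%N) ->
  (2 <= s)%N -> (m, s) <> (2%N, 2%N) -> admissible_transform H ->
  gamma * m%:R ^+ 2 <= s%:R -> (2 <= L)%N -> (2 * m <= n)%N ->
  (2 * n0 <= n)%N ->
  s%:R ^+ 2 * ln (2 * L%:R * (nblocks m)%:R / s%:R)
    <= 68 * L%:R * (nblocks m)%:R * n%:R ^+ 2 :> R ->
  attainable m n n0 s H
    ((n%:R * ln m%:R + L%:R * (n0%:R * ln (m%:R * n%:R * expR 1 / n0%:R))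
      + s%:R * ln (L%:R * m%:R ^+ 2 / s%:R)) / (2 ^+ 29 * (1 + `|ln gamma|))).
Proof.
move=> gg m1 mn0 s2 ms Hadm gms L2 mn n0n hs.
have gamma0 : 0 < gamma by case/andP: gg.
set T1 := n%:R * _; set T2 := L%:R * _; set T3 := s%:R * ln _.
have D0 : 0 < 1 + `|ln gamma| by have := normr_ge0 (ln gamma); lra.
have [r [r0 hr att3]] := attainable_sparse_rate n0 Hadm m1 s2 mn gamma0 gms L2 hs.
have att1 : T1 <= 0 \/
    attainable m n n0 s H (T1 / (9 * 2 ^+ 15 * (1 + `|ln gamma|))).
  have [m2|] := ltnP 1 m; first by right; apply: attainable_static_clusters.
  by move=> m_le; left; rewrite /T1 (_ : m = 1%N) ?ln1 ?mulr0 //; lia.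
have att2 : T2 <= 0 \/
    attainable m n n0 s H (T2 / (24 * 2 ^+ 15 * (1 + `|ln gamma|))).
  have [n00|n0_gt0] := posnP n0; first by left; rewrite /T2 n00 mul0r mulr0.
  right; apply: attainable_moving_clusters => //.
  by have [m2|] := eqVneq m 1%N; [move: n0_gt0; rewrite mn0|lia].
clear -D0 r0 hr att3 att1 att2; move: (1 + _) D0 hr att1 att2 => D D0 hr att1 att2.
have Dn0 : D != 0 by rewrite gt_eqF.
pose y1 := T1 / (9 * 2 ^+ 15 * D); pose y2 := T2 / (24 * 2 ^+ 15 * D).
have T1E : T1 = 9 * 2 ^+ 15 * D * y1 by rewrite /y1; field.
have T2E : T2 = 24 * 2 ^+ 15 * D * y2 by rewrite /y2; field.
have r18 : r = 2 ^+ 18 * (r / 2 ^+ 18) by field.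
rewrite -/y1 in att1; rewrite -/y2 in att2.
(* With [a] above the three separate bounds, the sum of the terms is at most [33 * 2^15 + 2^27]
   times [D a], below [2^29 D a]. *)
have E_le a : 0 <= a -> y1 <= a -> y2 <= a -> r / 2 ^+ 18 <= a ->
    (T1 + T2 + T3) / (2 ^+ 29 * D) <= a.
  move=> a0 h1 h2 h3; rewrite ler_pdivrMr ?mulr_gt0 ?exprn_gt0 //.
  have aD : 0 <= D * a by rewrite mulr_ge0 // ltW.
  have h1' := ler_wpM2l (ltW D0) h1; have h2' := ler_wpM2l (ltW D0) h2.
  have h3' := ler_wpM2l (ltW D0) h3.
  move: hr; rewrite T1E T2E -/T3 {1}r18; lra.
have r18_ge0 : 0 <= r / 2 ^+ 18 by rewrite divr_ge0 // exprn_ge0.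
(* The sparsity bound is always attainable and nonnegative; a clustering bound that exceeds it is
   positive, which rules out the degenerate alternative [T1 <= 0] or [T2 <= 0]. *)
have y1P : r / 2 ^+ 18 < y1 -> attainable m n n0 s H y1.
  move=> h; case: att1 => // T1_le; exfalso.
  have : 0 < D * y1 by rewrite mulr_gt0 //; lra.
  by move: T1_le; rewrite T1E; lra.
have y2P : r / 2 ^+ 18 < y2 -> attainable m n n0 s H y2.
  move=> h; case: att2 => // T2_le; exfalso.
  have : 0 < D * y2 by rewrite mulr_gt0 //; lra.
  by move: T2_le; rewrite T2E; lra.
have [h1|h1] := leP y1 (r / 2 ^+ 18); have [h2|h2] := leP y2 (r / 2 ^+ 18).
- by apply: attainable_le att3; apply: E_le.
- by apply: attainable_le (y2P h2); apply: E_le => //; lra.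
- by apply: attainable_le (y1P h1); apply: E_le => //; lra.
- have [h|h] := leP y1 y2.
    by apply: attainable_le (y2P h2); apply: E_le => //; lra.
  by apply: attainable_le (y1P h1); apply: E_le => //; lra.
Qed.

Theorem theorem3 (R : realType) :
  exists Cst : R -> R,
    (forall gamma : R, 0 < gamma -> 0 < Cst gamma) /\
    forall (kappa : R) (m n L n0 s : nat) (H : 'M[R]_L),
      let gamma := Num.min kappa (1 / 2) in
      let M := (m * m.+1)./2 in
      let rate : R :=
        ln m%:R / (n%:R * L%:R)
        + n0%:R / n%:R ^+ 2 * ln (m%:R * n%:R * expR 1 / n0%:R)
        + s%:R * ln (L%:R * m%:R ^+ 2 / s%:R) / (n%:R ^+ 2 * L%:R) in
      0 < kappa ->
      (1 <= m)%N -> (m = 1%N -> n0 = 0%N) ->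
      (2 <= s)%N -> (m, s) <> (2%N, 2%N) ->
      admissible_transform H ->
      kappa * m%:R ^+ 2 <= s%:R ->
      (2 <= L)%N ->
      (2 * m <= n)%N ->
      n0%:R <= Num.min (gamma * n%:R)
                       (4 / 3 * gamma * n%:R * m%:R `^ (- (1 / 9))) ->
      s%:R ^+ 2 * ln (2 * L%:R * M%:R / s%:R)
        <= 68 * L%:R * M%:R * n%:R ^+ 2 :> R ->
      ((1 / 4 : R)%:E <=
       ereal_inf (range (fun Lamhat : estimator R n L =>
         ereal_sup
           [set let Lam := dsbm G C in
                (Prob Lam (fun B =>
                   Cst gamma * rate <=
                   tensor_norm (tensor_sub (Lamhat B) Lam) ^+ 2
                   / (n%:R ^+ 2 * L%:R)))%R%:E
           | G in sparse_connectivity m s H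
           & C in clustering_seqs m n n0 L])))%E.
Proof.
exists (fun gamma => (2 ^+ 29 * (1 + `|ln gamma|))^-1); split.
  by move=> gamma _; rewrite invr_gt0 mulr_gt0 ?exprn_gt0.
move=> kappa m n L n0 s H gamma M rate kappa0 m1 mn0 s2 ms Hadm kms L2 mn n0_le hs.
have gg : 0 < gamma <= 1 / 2.
  by rewrite /gamma lt_min kappa0 ge_min lexx orbT andbT /=; lra.
have gms : gamma * m%:R ^+ 2 <= s%:R.
  by apply: le_trans kms; rewrite ler_wpM2r ?sqr_ge0 // ge_min lexx.
(* Since [gamma <= 1/2], [n0] disjoint slots fit in the first half of the nodes. *)
have n0n : (2 * n0 <= n)%N.
  rewrite -(ler_nat R) natrM; move: n0_le; rewrite le_min => /andP[h _].
  have n_ge0 := ler0n R n; case/andP: gg => _ g1.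
  by have := ler_wpM2r n_ge0 g1; lra.
have := attainable_rate gg m1 mn0 s2 ms Hadm gms L2 mn n0n.
rewrite card_block -/M => /(_ hs) att.
apply/ereal_infP => _ [Lamhat _ <-].
have [G [C [GS CS _ P]]] := att Lamhat.
apply: (@le_trans _ _ (Prob (dsbm G C) (fun B =>
    (2 ^+ 29 * (1 + `|ln gamma|))^-1 * rate <=
    tensor_norm (tensor_sub (Lamhat B) (dsbm G C)) ^+ 2
      / (n%:R ^+ 2 * L%:R)))%:E); last first.
  by apply: ereal_sup_ubound; exists G => //; exists C.
rewrite lee_fin; apply: (le_trans P); rewrite le_eqVlt; apply/orP; left.
apply/eqP; apply: eq_bigl => x; rewrite tensor_norm_sub.
have nR : 0 < n%:R :> R by rewrite ltr0n; drop_reals; lia.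
have LR : 0 < L%:R :> R by rewrite ltr0n; drop_reals; lia.
rewrite ler_pdivlMr ?mulr_gt0 ?exprn_gt0 //; congr (_ <= _).
rewrite /rate [in LHS]mulrC -[RHS]mulrA; congr (_ * _).
by field; rewrite !gt_eqF.
Qed.
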